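(* Let $\mathcal D_{\mathrm{dg}}$ be a non-positive stable DG-category, let $(\mathcal D_{\mathrm{dg}}^{\le0},\mathcal D_{\mathrm{dg}}^{\ge0})$ be a $t$-structure on it, and let $n$ be a positive integer. Then the $n$-extended heart $\mathcal D_{\mathrm{dg}}^{[-n+1,0]}$ is an abelian $n$-truncated DG-category.
   Context: **DG-categories.** Let $k$ be a commutative ring. DG-categories are $k$-linear with cohomological grading (differential $d$ of degree $+1$). All DG-categories $\mathcal A$ are assumed non-positive: $\mathcal A(X,Y)^i=0$ for $i>0$. A morphism $f$ is closed if $d(f)=0$. $H^0(\mathcal A)$ is the homotopy category. **Exactness.** For a chain map $\varphi:M\to N$ let $\mathrm{Fib}(\varphi)=\mathrm{Cone}(\varphi)[-1]$ be the complex $\mathrm{Fib}(\varphi)^i=M^i\oplus N^{i-1}$, $d(m,h)=(dm,-\varphi(m)-dh)$. A 3-term homotopy complex $(f,g,h)$ consists of closed degree-$0$ morphisms $f:X\to Y$, $g:Y\to Z$ and a degree $-1$ morphism $h:X\to Z$ with $d(h)=-g\circ f$. It is left exact (a homotopy kernel of $g$) if for every object $W$ and every $i\le 0$ the chain map $\mathcal A(W,X)\to \mathrm{Fib}(g\circ-:\mathcal A(W,Y)\to\mathcal A(W,Z))$, $u\mapsto (f\circ u,h\circ u)$, induces an isomorphism on $H^i$. It is right exact (a homotopy cokernel of $f$) if for every $W$ and $i\le0$ the chain map $\mathcal A(Z,W)\to\mathrm{Fib}(-\circ f:\mathcal A(Y,W)\to\mathcal A(X,W))$, $u\mapsto(u\circ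 g,(-1)^{|u|}u\circ h)$, induces an isomorphism on $H^i$. It is a homotopy short exact sequence if it is both. $\mathcal A$ is preabelian if $H^0(\mathcal A)$ is additive and every closed degree-$0$ morphism has a homotopy kernel and a homotopy cokernel. **Abelian $n$-truncated DG-categories.** A closed degree-$0$ morphism $f:X\to Y$ is an $n$-monomorphism if for every $W$ the map $H^i(f\circ-):H^i(\mathcal A(W,X))\to H^i(\mathcal A(W,Y))$ is injective for $i=-n+1$ and bijective for all $i\le -n$; it is an $n$-epimorphism if it is an $n$-monomorphism in $\mathcal A^{\mathrm{op}}$. $\mathcal A$ is $n$-truncated if $H^i(\mathcal A(X,Y))=0$ for all $X,Y$ and all $i\le -n$. $\mathcal A$ is abelian $n$-truncated if it is $n$-truncated and: (i) it is preabelian; (ii) every right exact $(f,g,h)$ with $f$ an $n$-monomorphism is a homotopy short exact sequence; (iii) every left exact $(f,g,h)$ with $g$ an $n$-epimorphism is a homotopy short exact sequence. **Stable DG-categories.** $\mathcal D_{\mathrm{dg}}$ is stable if it is preabelian and, for 3-term homotopy complexes, being left exact, being right exact and being homotopy short exact are equivalent. Then $\mathcal D:=H^0(\mathcal D_{\mathrm{dg}})$ is a triangulated category: the shift $[1]$ sends $X$ to the suspension object $\Sigma X$ (an object with a closed degree $-1$ morphism $h^X:X\to\Sigma X$ inducing isomorphisms $H^i(\mathcal D_{\mathrm{dg}}(\Sigma X,W))\cong H^{i-1}(\mathcal D_{\mathrm{dg}}(X,W))$ for all $W$, $i\le0$); the distinguished triangles are those isomorphic to $A_0\xrightarrow{f_0}A_1\xrightarrow{f_1}A_2\xrightarrow{f_2}\Sigma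 A_0$ with $(f_0,f_1,h^{f_0})$ homotopy short exact and $f_2$ such that there exist $h^{f_1}$ of degree $-1$ with $d(h^{f_1})=-f_2f_1$ and $\eta$ of degree $-2$ with $d(\eta)=h^{A_0}+f_2h^{f_0}-h^{f_1}f_0$. One has $H^i(\mathcal D_{\mathrm{dg}}(X,Y))\cong\mathcal D(X,Y[i])$ for $i\le 0$. **$t$-structures.** A $t$-structure on $\mathcal D_{\mathrm{dg}}$ is a pair of full sub-DG-categories $(\mathcal D_{\mathrm{dg}}^{\le0},\mathcal D_{\mathrm{dg}}^{\ge0})$ which forms a $t$-structure (in the usual sense) on $\mathcal D$. $\mathcal D_{\mathrm{dg}}^{\le m}$, $\mathcal D_{\mathrm{dg}}^{\ge m}$ are the full sub-DG-categories on objects belonging to $\mathcal D^{\le m}=\mathcal D^{\le0}[-m]$, $\mathcal D^{\ge m}=\mathcal D^{\ge0}[-m]$. The $n$-extended heart is the full sub-DG-category $\mathcal D_{\mathrm{dg}}^{[-n+1,0]}:=\mathcal D_{\mathrm{dg}}^{\le0}\cap\mathcal D_{\mathrm{dg}}^{\ge-n+1}$. *)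

(* Defs.v *)
From mathcomp Require Import all_boot all_order all_algebra.
From mathcomp Require Import zify.

Set Implicit Arguments.
Unset Strict Implicit.
Unset Printing Implicit Defensive.

Import Order.TTheory GRing.Theory Num.Theory.
Local Open Scope ring_scope.

(* Degrees are integers.  Operations whose target degree is computed from the
   source degrees (differential, composition) take that target degree and a
   proof of the corresponding equation, so that statements such as
   associativity or the Leibniz rule typecheck without transport. *)

Definition ksgn (k : comPzRingType) (i : int) : k := (-1) ^+ `|i|%N.
Arguments ksgn {k} i.

Lemma ksgnE (k : comPzRingType) (i : int) : ksgn i = (-1) ^+ (odd `|i|%N) :> k.
Proof. by rewrite /ksgn signr_odd. Qed.

Lemma ksgnD (k : comPzRingType) (i j : int) :
  ksgn (i + j) = ksgn i * ksgn j :> k.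
Proof. by rewrite !ksgnE -signr_addb; congr (_ ^+ _); lia. Qed.

Lemma ksgnS (k : comPzRingType) (i j : int) :
  i + 1 = j -> ksgn j = - ksgn i :> k.
Proof. by move=> <-; rewrite ksgnD /ksgn expr1 mulrN1. Qed.

Lemma ksgnK (k : comPzRingType) (i : int) : ksgn i * ksgn i = 1 :> k.
Proof. by rewrite !ksgnE -signr_addb addbb. Qed.

Record complex (k : comPzRingType) := Complex {
  cx_mod :> int -> lmodType k;
  df : forall i j : int, i + 1 = j -> cx_mod i -> cx_mod j;
  df_linear : forall i j (e : i + 1 = j), linear (df e);
  df_df : forall i j l (e : i + 1 = j) (e' : j + 1 = l) (x : cx_mod i),
    df e' (df e x) = 0
}.
Arguments df {k} c {i j} e x.

Section ComplexLemmas.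
Variables (k : comPzRingType) (C : complex k).

Lemma dfD i j (e : i + 1 = j) (x y : C i) :
  df C e (x + y) = df C e x + df C e y.
Proof. by have := df_linear e 1 x y; rewrite !scale1r. Qed.

Lemma df0 i j (e : i + 1 = j) : df C e 0 = 0.
Proof. by apply: (addIr (df C e 0)); rewrite -dfD !add0r. Qed.

Lemma dfZ i j (e : i + 1 = j) a (x : C i) : df C e (a *: x) = a *: df C e x.
Proof. by have := df_linear e a x 0; rewrite df0 !addr0. Qed.

Lemma dfN i j (e : i + 1 = j) (x : C i) : df C e (- x) = - df C e x.
Proof. by rewrite -scaleN1r dfZ scaleN1r. Qed.

Lemma dfB i j (e : i + 1 = j) (x y : C i) :
  df C e (x - y) = df C e x - df C e y.
Proof. by rewrite dfD dfN. Qed.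

End ComplexLemmas.

Definition cocycle (k : comPzRingType) (C : complex k) (i : int) (x : C i) :=
  forall j (e : i + 1 = j), df C e x = 0.

Definition coboundary (k : comPzRingType) (C : complex k) (i : int)
    (x : C i) :=
  exists j (e : j + 1 = i) (y : C j), x = df C e y.

(* Equality of the classes of two cocycles in H^i(C). *)
Definition cohomologous (k : comPzRingType) (C : complex k) (i : int)
    (x y : C i) :=
  coboundary (x - y).

(* H^i(C) is the set of degree-i cocycles with equality [cohomologous]; the
   next four notions are read off from this presentation.  In the last three,
   F is meant to be (a component of) a map that commutes with differentials up
   to sign, hence acts on cohomology classes. *)
Definition H_zero (k : comPzRingType) (C : complex k) (i : int) :=
  forall x : C i, cocycle x -> cohomologous x 0.

Definition H_injective (k : comPzRingType) (C D : complex k) (i j : int)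
    (F : C i -> D j) :=
  forall x y : C i, cocycle x -> cocycle y ->
    cohomologous (F x) (F y) -> cohomologous x y.

Definition H_surjective (k : comPzRingType) (C D : complex k) (i j : int)
    (F : C i -> D j) :=
  forall z : D j, cocycle z ->
    exists x : C i, cocycle x /\ cohomologous (F x) z.

Definition H_bijective (k : comPzRingType) (C D : complex k) (i j : int)
    (F : C i -> D j) :=
  H_injective F /\ H_surjective F.

Record chainmap (k : comPzRingType) (M N : complex k) := ChainMap {
  cm_fun :> forall i : int, M i -> N i;
  cm_linear : forall i, linear (@cm_fun i);
  cm_df : forall i j (e : i + 1 = j) (x : M i),
    cm_fun (df M e x) = df N e (cm_fun x)
}.
Arguments cm_fun {k M N} c i x.

Definition castdeg (k : comPzRingType) (C : complex k) (i j : int)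
    (e : i = j) (x : C i) : C j :=
  eq_rect i (fun l => C l : Type) x j e.
Arguments castdeg {k} C {i j} e x.

Lemma castdeg_linear (k : comPzRingType) (C : complex k) (i j : int)
  (e : i = j) : linear (castdeg C e).
Proof. by move=> a x y; case: _ / e. Qed.

Lemma df_castdeg (k : comPzRingType) (C : complex k) (i i' j j' : int)
  (ei : i = i') (ej : j = j') (e : i + 1 = j) (e' : i' + 1 = j') (x : C i) :
  df C e' (castdeg C ei x) = castdeg C ej (df C e x).
Proof. by subst i' j'; rewrite /= (eq_irrelevance e' e). Qed.

Fact fib_deg_df (i j : int) : i + 1 = j -> i - 1 + 1 = j - 1.
Proof. by move=> <-; rewrite subrK addrK. Qed.

Fact fib_deg_map (i j : int) : i + 1 = j -> i = j - 1.
Proof. by move=> <-; rewrite addrK. Qed.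

Section Fib.
Variables (k : comPzRingType) (M N : complex k) (phi : chainmap M N).

Definition fib_mod (i : int) : lmodType k := (M i * N (i - 1))%type.

Definition fib_df (i j : int) (e : i + 1 = j) (x : fib_mod i) : fib_mod j :=
  (df M e x.1,
   - castdeg N (fib_deg_map e) (phi i x.1) - df N (fib_deg_df e) x.2).

Fact fib_df_linear i j (e : i + 1 = j) : linear (fib_df e).
Proof.
move=> a x y; rewrite /fib_df /=; congr (_, _); first exact: df_linear.
rewrite /= cm_linear castdeg_linear df_linear !opprD -!scalerN.
by rewrite [LHS]addrACA -scalerDr.
Qed.

Fact fib_df_df i j l (e : i + 1 = j) (e' : j + 1 = l) (x : fib_mod i) :
  fib_df e' (fib_df e x) = 0.
Proof.
rewrite /fib_df /= df_df dfB dfN df_df subr0 opprK cm_df.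
by rewrite (df_castdeg _ (fib_deg_map e') e) addNr.
Qed.

(* This is Cone(phi)[-1]. *)
Definition Fib : complex k := Complex fib_df_linear fib_df_df.

End Fib.

(* d (id) = 0 need not be required: it follows from the Leibniz rule. *)
Record dgCat (k : comPzRingType) := DGCat {
  dg_obj :> Type;
  dhom : dg_obj -> dg_obj -> complex k;
  dcomp : forall (X Y Z : dg_obj) (i j l : int), i + j = l ->
    dhom Y Z i -> dhom X Y j -> dhom X Z l;
  did : forall X : dg_obj, dhom X X 0;
  dcomp_linearl : forall X Y Z i j l (e : i + j = l) (f : dhom X Y j),
    linear (fun g : dhom Y Z i => dcomp e g f);
  dcomp_linearr : forall X Y Z i j l (e : i + j = l) (g : dhom Y Z i),
    linear (fun f : dhom X Y j => dcomp e g f);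
  dcompA : forall (X Y Z T : dg_obj) (a b c ab bc abc : int)
    (e1 : a + b = ab) (e2 : ab + c = abc) (e3 : b + c = bc) (e4 : a + bc = abc)
    (h : dhom Z T a) (g : dhom Y Z b) (f : dhom X Y c),
    dcomp e2 (dcomp e1 h g) f = dcomp e4 h (dcomp e3 g f);
  dcomp1f : forall X Y i (e : 0 + i = i) (f : dhom X Y i),
    dcomp e (did Y) f = f;
  dcompf1 : forall X Y i (e : i + 0 = i) (f : dhom X Y i),
    dcomp e f (did X) = f;
  dleibniz : forall X Y Z (i j l i' j' l' : int)
    (e : i + j = l) (ei : i + 1 = i') (ej : j + 1 = j') (el : l + 1 = l')
    (eg : i' + j = l') (ef : i + j' = l') (g : dhom Y Z i) (f : dhom X Y j),
    df (dhom X Z) el (dcomp e g f)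
      = dcomp eg (df (dhom Y Z) ei g) f
        + ksgn i *: dcomp ef g (df (dhom X Y) ej f);
  dnonpos : forall X Y (i : int) (f : dhom X Y i), 0 < i -> f = 0
}.
Arguments dhom {k d} X Y.
Arguments dcomp {k d X Y Z i j l} e g f.
Arguments did {k d} X.

Section CompLemmas.
Variables (k : comPzRingType) (A : dgCat k) (X Y Z : A) (i j l : int).
Variable e : i + j = l.
Implicit Types (g : dhom Y Z i) (f : dhom X Y j).

Lemma dcompDl g g' f : dcomp e (g + g') f = dcomp e g f + dcomp e g' f.
Proof. by have := dcomp_linearl e f 1 g g'; rewrite !scale1r. Qed.

Lemma dcompDr g f f' : dcomp e g (f + f') = dcomp e g f + dcomp e g f'.
Proof. by have := dcomp_linearr e g 1 f f'; rewrite !scale1r. Qed.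

Lemma dcomp0l f : dcomp e 0 f = 0 :> dhom X Z l.
Proof. by apply: (addIr (dcomp e 0 f)); rewrite -dcompDl !add0r. Qed.

Lemma dcomp0r g : dcomp e g 0 = 0 :> dhom X Z l.
Proof. by apply: (addIr (dcomp e g 0)); rewrite -dcompDr !add0r. Qed.

Lemma dcompZl a g f : dcomp e (a *: g) f = a *: dcomp e g f.
Proof. by have := dcomp_linearl e f a g 0; rewrite dcomp0l !addr0. Qed.

Lemma dcompZr a g f : dcomp e g (a *: f) = a *: dcomp e g f.
Proof. by have := dcomp_linearr e g a f 0; rewrite dcomp0r !addr0. Qed.

Lemma dcompNl g f : dcomp e (- g) f = - dcomp e g f.
Proof. by rewrite -scaleN1r dcompZl scaleN1r. Qed.

Lemma dcompNr g f : dcomp e g (- f) = - dcomp e g f.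
Proof. by rewrite -scaleN1r dcompZr scaleN1r. Qed.

End CompLemmas.

Lemma castdeg_dcomp (k : comPzRingType) (A : dgCat k) (X Y Z : A)
  (i j l l' : int) (el : l = l') (e : i + j = l) (e' : i + j = l')
  (g : dhom Y Z i) (f : dhom X Y j) :
  castdeg (dhom X Z) el (dcomp e g f) = dcomp e' g f.
Proof. by subst l'; rewrite /= (eq_irrelevance e' e). Qed.

Section Opposite.
Variables (k : comPzRingType) (A : dgCat k).

Let ohom (X Y : A) : complex k := dhom Y X.

Fact op_deg (i j l : int) : i + j = l -> j + i = l.
Proof. by rewrite addrC. Qed.

Definition op_comp (X Y Z : A) (i j l : int) (e : i + j = l)
    (g : ohom Y Z i) (f : ohom X Y j) : ohom X Z l :=
  ksgn (i * j) *: dcomp (op_deg e) f g.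

Fact op_linearl X Y Z i j l (e : i + j = l) (f : ohom X Y j) :
  linear (fun g : ohom Y Z i => op_comp e g f).
Proof.
move=> a x y; rewrite /op_comp dcomp_linearr scalerDr !scalerA.
by rewrite [ksgn _ * a]mulrC.
Qed.

Fact op_linearr X Y Z i j l (e : i + j = l) (g : ohom Y Z i) :
  linear (fun f : ohom X Y j => op_comp e g f).
Proof.
move=> a x y; rewrite /op_comp dcomp_linearl scalerDr !scalerA.
by rewrite [ksgn _ * a]mulrC.
Qed.

Fact op_compA (X Y Z T : A) (a b c ab bc abc : int)
  (e1 : a + b = ab) (e2 : ab + c = abc) (e3 : b + c = bc) (e4 : a + bc = abc)
  (h : ohom Z T a) (g : ohom Y Z b) (f : ohom X Y c) :
  op_comp e2 (op_comp e1 h g) f = op_comp e4 h (op_comp e3 g f).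
Proof.
rewrite /op_comp dcompZl dcompZr !scalerA -!ksgnD.
rewrite -(dcompA (op_deg e3) (op_deg e4) (op_deg e1) (op_deg e2)).
congr (ksgn _ *: _); subst ab bc; lia.
Qed.

Fact op_comp1f X Y i (e : 0 + i = i) (f : ohom X Y i) :
  op_comp e (did Y) f = f.
Proof. by rewrite /op_comp dcompf1 mul0r scale1r. Qed.

Fact op_compf1 X Y i (e : i + 0 = i) (f : ohom X Y i) :
  op_comp e f (did X) = f.
Proof. by rewrite /op_comp dcomp1f mulr0 scale1r. Qed.

Fact op_leibniz X Y Z (i j l i' j' l' : int)
  (e : i + j = l) (ei : i + 1 = i') (ej : j + 1 = j') (el : l + 1 = l')
  (eg : i' + j = l') (ef : i + j' = l') (g : ohom Y Z i) (f : ohom X Y j) :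
  df (ohom X Z) el (op_comp e g f)
    = op_comp eg (df (ohom Y Z) ei g) f
      + ksgn i *: op_comp ef g (df (ohom X Y) ej f).
Proof.
rewrite /op_comp dfZ (dleibniz _ ej ei _ (op_deg ef) (op_deg eg)).
rewrite scalerDr !scalerA addrC -!ksgnD; congr (_ + _).
  by congr (ksgn _ *: _); subst i'; lia.
subst j'; congr (_ *: _); rewrite !ksgnE; congr (_ ^+ _); lia.
Qed.

Definition op : dgCat k :=
  @DGCat k A ohom op_comp (fun X => did X) op_linearl op_linearr op_compA
    op_comp1f op_compf1 op_leibniz
    (fun X Y i f => @dnonpos k A Y X i f).

End Opposite.

Definition full_sub (k : comPzRingType) (A : dgCat k) (P : A -> Prop) :
    dgCat k :=
  @DGCat k {X : A | P X}
    (fun X Y => dhom (sval X) (sval Y))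
    (fun X Y Z i j l e g f => dcomp e g f)
    (fun X => did (sval X))
    (fun X Y Z => @dcomp_linearl k A (sval X) (sval Y) (sval Z))
    (fun X Y Z => @dcomp_linearr k A (sval X) (sval Y) (sval Z))
    (fun X Y Z T => @dcompA k A (sval X) (sval Y) (sval Z) (sval T))
    (fun X Y => @dcomp1f k A (sval X) (sval Y))
    (fun X Y => @dcompf1 k A (sval X) (sval Y))
    (fun X Y Z => @dleibniz k A (sval X) (sval Y) (sval Z))
    (fun X Y => @dnonpos k A (sval X) (sval Y)).

(* Morphisms of H^0(A) are closed degree-0 morphisms; equality of morphisms is
   [cohomologous]. *)
Definition closed (k : comPzRingType) (A : dgCat k) (X Y : A) (i : int)
    (f : dhom X Y i) :=
  cocycle f.

Definition comp0 (k : comPzRingType) (A : dgCat k) (X Y Z : A)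
    (g : dhom Y Z 0) (f : dhom X Y 0) : dhom X Z 0 :=
  dcomp (addr0 0) g f.

Definition H0_iso (k : comPzRingType) (A : dgCat k) (X Y : A)
    (f : dhom X Y 0) :=
  closed f /\
  exists g : dhom Y X 0, closed g /\
    cohomologous (comp0 g f) (did X) /\ cohomologous (comp0 f g) (did Y).

Definition H0_isomorphic (k : comPzRingType) (A : dgCat k) (X Y : A) :=
  exists f : dhom X Y 0, H0_iso f.

Definition H0_zero_object (k : comPzRingType) (A : dgCat k) (O : A) :=
  forall X : A,
    (forall f : dhom X O 0, closed f -> cohomologous f 0) /\
    (forall f : dhom O X 0, closed f -> cohomologous f 0).

Definition H0_biproduct (k : comPzRingType) (A : dgCat k) (X Y S : A) :=
  exists (i1 : dhom X S 0) (i2 : dhom Y S 0)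
         (p1 : dhom S X 0) (p2 : dhom S Y 0),
    [/\ closed i1, closed i2, closed p1 & closed p2] /\
    [/\ cohomologous (comp0 p1 i1) (did X), cohomologous (comp0 p2 i2) (did Y),
        cohomologous (comp0 p2 i1) 0, cohomologous (comp0 p1 i2) 0 &
        cohomologous (comp0 i1 p1 + comp0 i2 p2) (did S)].

(* H^0(A) is k-linear by construction. *)
Definition H0_additive (k : comPzRingType) (A : dgCat k) :=
  (exists O : A, H0_zero_object O) /\
  (forall X Y : A, exists S : A, H0_biproduct X Y S).

Record hcomplex3 (k : comPzRingType) (A : dgCat k) (X Y Z : A) := HComplex3 {
  hc_f : dhom X Y 0;
  hc_g : dhom Y Z 0;
  hc_h : dhom X Z (-1);
  hc_f_closed : closed hc_f;
  hc_g_closed : closed hc_g;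
  hc_dh : df (dhom X Z) (addNr 1) hc_h = - comp0 hc_g hc_f
}.

Section PrePost.
Variables (k : comPzRingType) (A : dgCat k).

Fact postcomp_df (W Y Z : A) (g : dhom Y Z 0) (cg : closed g)
  i j (e : i + 1 = j) (u : dhom W Y i) :
  dcomp (add0r j) g (df _ e u) = df (dhom W Z) e (dcomp (add0r i) g u).
Proof.
have eg : 1 + i = j by rewrite addrC.
rewrite (dleibniz _ (add0r 1) e e eg (add0r j)) cg dcomp0l add0r.
by rewrite /ksgn scale1r.
Qed.

Fact precomp_df (X Y W : A) (f : dhom X Y 0) (cf : closed f)
  i j (e : i + 1 = j) (u : dhom Y W i) :
  dcomp (addr0 j) (df _ e u) f = df (dhom X W) e (dcomp (addr0 i) u f).
Proof.
rewrite (dleibniz _ e (add0r 1) e (addr0 j) e) cf dcomp0r scaler0.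
by rewrite addr0.
Qed.

Definition postcomp (W Y Z : A) (g : dhom Y Z 0) (cg : closed g) :
    chainmap (dhom W Y) (dhom W Z) :=
  @ChainMap k _ _ (fun i u => dcomp (add0r i) g u)
    (fun i => dcomp_linearr (add0r i) g) (postcomp_df cg).

Definition precomp (X Y W : A) (f : dhom X Y 0) (cf : closed f) :
    chainmap (dhom Y W) (dhom X W) :=
  @ChainMap k _ _ (fun i u => dcomp (addr0 i) u f)
    (fun i => dcomp_linearl (addr0 i) f) (precomp_df cf).

End PrePost.

Section Comparison.
Variables (k : comPzRingType) (A : dgCat k) (X Y Z : A).
Variable T : hcomplex3 X Y Z.
Let f := hc_f T.
Let g := hc_g T.
Let h := hc_h T.

Definition left_fib (W : A) : complex k :=
  Fib (postcomp W (hc_g_closed T)).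

Definition left_cmp_fun (W : A) (i : int) (u : dhom W X i) : left_fib W i :=
  (dcomp (add0r i) f u, dcomp (addrC (-1) i) h u).

Fact left_cmp_linear W i : linear (@left_cmp_fun W i).
Proof. by move=> a u v; rewrite /left_cmp_fun !dcomp_linearr. Qed.

Fact left_cmp_df W i j (e : i + 1 = j) (u : dhom W X i) :
  left_cmp_fun (df _ e u) = df (left_fib W) e (left_cmp_fun u).
Proof.
rewrite /left_cmp_fun /= /fib_df /=; congr (_, _).
  exact: (postcomp_df (hc_f_closed T)).
have ei : 0 + i = j - 1 by rewrite add0r; exact: fib_deg_map.
rewrite (dleibniz _ (addNr 1) e _ ei (addrC (-1) j)) hc_dh.
rewrite dcompNl (dcompA (addr0 0) ei (add0r i) ei).
rewrite (castdeg_dcomp _ _ ei) opprD opprK addKr.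
by rewrite /ksgn expr1 scaleN1r opprK.
Qed.

Definition left_cmp (W : A) : chainmap (dhom W X) (left_fib W) :=
  ChainMap (@left_cmp_linear W) (@left_cmp_df W).

Definition right_fib (W : A) : complex k :=
  Fib (precomp W (hc_f_closed T)).

Definition right_cmp_fun (W : A) (i : int) (u : dhom Z W i) : right_fib W i :=
  (dcomp (addr0 i) u g, ksgn i *: dcomp (erefl (i - 1)) u h).

Fact right_cmp_linear W i : linear (@right_cmp_fun W i).
Proof.
move=> a u v; rewrite /right_cmp_fun !dcomp_linearl; congr (_, _).
by rewrite /= scalerDr !scalerA [ksgn i * a]mulrC.
Qed.

Fact right_cmp_df W i j (e : i + 1 = j) (u : dhom Z W i) :
  right_cmp_fun (df _ e u) = df (right_fib W) e (right_cmp_fun u).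
Proof.
rewrite /right_cmp_fun /= /fib_df /=; congr (_, _).
  exact: (precomp_df (hc_g_closed T)).
have ei : i + 0 = j - 1 by rewrite addr0; exact: fib_deg_map.
rewrite dfZ (dleibniz _ e (addNr 1) _ (erefl (j - 1)) ei) hc_dh.
rewrite dcompNr -(dcompA (addr0 i) ei (addr0 0) ei).
rewrite (castdeg_dcomp _ _ ei) scalerDr scalerA ksgnK scale1r.
by rewrite opprD opprK addrCA addNr addr0 (ksgnS _ e) scaleNr.
Qed.

Definition right_cmp (W : A) : chainmap (dhom Z W) (right_fib W) :=
  ChainMap (@right_cmp_linear W) (@right_cmp_df W).

Definition left_exact :=
  forall (W : A) (i : int), i <= 0 -> H_bijective (left_cmp W i).

Definition right_exact :=
  forall (W : A) (i : int), i <= 0 -> H_bijective (right_cmp W i).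

Definition short_exact := left_exact /\ right_exact.

End Comparison.

Definition has_homotopy_kernel (k : comPzRingType) (A : dgCat k) (Y Z : A)
    (g : dhom Y Z 0) :=
  exists (X : A) (T : hcomplex3 X Y Z), hc_g T = g /\ left_exact T.

Definition has_homotopy_cokernel (k : comPzRingType) (A : dgCat k) (X Y : A)
    (f : dhom X Y 0) :=
  exists (Z : A) (T : hcomplex3 X Y Z), hc_f T = f /\ right_exact T.

Definition preabelian (k : comPzRingType) (A : dgCat k) :=
  H0_additive A /\
  forall (X Y : A) (f : dhom X Y 0), closed f ->
    has_homotopy_kernel f /\ has_homotopy_cokernel f.

Definition n_mono (k : comPzRingType) (A : dgCat k) (n : nat) (X Y : A)
    (f : dhom X Y 0) :=
  closed f /\
  forall W : A,
    H_injective
      (fun u : dhom W X (- n%:Z + 1) => dcomp (add0r _) f u : dhom W Y _) /\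
    (forall i : int, i <= - n%:Z ->
      H_bijective (fun u : dhom W X i => dcomp (add0r i) f u : dhom W Y i)).

Definition n_epi (k : comPzRingType) (A : dgCat k) (n : nat) (X Y : A)
    (f : dhom X Y 0) :=
  @n_mono k (op A) n Y X f.

Definition n_truncated (k : comPzRingType) (A : dgCat k) (n : nat) :=
  forall (X Y : A) (i : int), i <= - n%:Z -> H_zero (dhom X Y) i.

Definition abelian_n_truncated (k : comPzRingType) (A : dgCat k) (n : nat) :=
  [/\ n_truncated A n,
      preabelian A,
      forall (X Y Z : A) (T : hcomplex3 X Y Z),
        right_exact T -> n_mono n (hc_f T) -> short_exact T &
      forall (X Y Z : A) (T : hcomplex3 X Y Z),
        left_exact T -> n_epi n (hc_g T) -> short_exact T].

Definition stable (k : comPzRingType) (A : dgCat k) :=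
  preabelian A /\
  forall (X Y Z : A) (T : hcomplex3 X Y Z),
    (left_exact T <-> right_exact T) /\ (right_exact T <-> short_exact T).

Definition is_suspension (k : comPzRingType) (A : dgCat k) (X S : A)
    (h : dhom X S (-1)) :=
  closed h /\
  forall (W : A) (i : int), i <= 0 ->
    H_bijective
      (fun u : dhom S W i => dcomp (erefl (i - 1)) u h : dhom X W (i - 1)).

(* Suspensions, hence shifts, are unique up to isomorphism in H^0 and are
   handled as relations: [shift m X Y] says that Y is isomorphic to X[m]. *)
Fixpoint shift_nat (k : comPzRingType) (A : dgCat k) (m : nat) (X Y : A) :
    Prop :=
  match m with
  | 0%N => H0_isomorphic X Y
  | m'.+1 => exists (S : A) (h : dhom X S (-1)),
      is_suspension h /\ shift_nat m' S Y
  end.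

Definition shift (k : comPzRingType) (A : dgCat k) (m : int) (X Y : A) : Prop :=
  match m with
  | Posz p => shift_nat p X Y
  | Negz p => shift_nat p.+1 Y X
  end.

Definition standard_triangle (k : comPzRingType) (A : dgCat k)
    (A0 A1 A2 SA0 : A) (hA0 : dhom A0 SA0 (-1))
    (f0 : dhom A0 A1 0) (f1 : dhom A1 A2 0) (f2 : dhom A2 SA0 0) :=
  is_suspension hA0 /\ closed f2 /\
  exists T : hcomplex3 A0 A1 A2,
    [/\ hc_f T = f0, hc_g T = f1, short_exact T &
      exists (hf1 : dhom A1 SA0 (-1)) (eta : dhom A0 SA0 (- 2)),
        df (dhom A1 SA0) (addNr 1) hf1 = - comp0 f2 f1 /\
        df (dhom A0 SA0) (erefl : - 2 + 1 = - 1 :> int) eta =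
          hA0 + dcomp (add0r (-1)) f2 (hc_h T)
              - dcomp (addr0 (-1)) hf1 f0].

(* The condition on a3 says that a3 is the image of a0 under the shift
   functor. *)
Definition distinguished (k : comPzRingType) (A : dgCat k)
    (X0 X1 X2 SX0 : A) (hX0 : dhom X0 SX0 (-1))
    (g0 : dhom X0 X1 0) (g1 : dhom X1 X2 0) (g2 : dhom X2 SX0 0) :=
  is_suspension hX0 /\ [/\ closed g0, closed g1 & closed g2] /\
  exists (A0 A1 A2 SA0 : A) (hA0 : dhom A0 SA0 (-1))
      (f0 : dhom A0 A1 0) (f1 : dhom A1 A2 0) (f2 : dhom A2 SA0 0)
      (a0 : dhom A0 X0 0) (a1 : dhom A1 X1 0) (a2 : dhom A2 X2 0)
      (a3 : dhom SA0 SX0 0),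
    [/\ standard_triangle hA0 f0 f1 f2,
        [/\ H0_iso a0, H0_iso a1, H0_iso a2 & closed a3],
        cohomologous (dcomp (add0r (-1)) a3 hA0)
                     (dcomp (addr0 (-1)) hX0 a0) &
        [/\ cohomologous (comp0 a1 f0) (comp0 g0 a0),
            cohomologous (comp0 a2 f1) (comp0 g1 a1) &
            cohomologous (comp0 a3 f2) (comp0 g2 a2)]].

Section TStructures.
Variables (k : comPzRingType) (D : dgCat k).

(* P[m], as a class of objects closed under isomorphism *)
Definition shift_class (P : D -> Prop) (m : int) (X : D) : Prop :=
  exists Z : D, P Z /\ shift m Z X.

(* For P = D^{<=0} (resp. D^{>=0}) this is D^{<=m} (resp. D^{>=m}). *)
Definition t_class (P : D -> Prop) (m : int) : D -> Prop :=
  shift_class P (- m).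

Definition iso_closed (P : D -> Prop) :=
  forall X Y : D, H0_isomorphic X Y -> P X -> P Y.

Definition t_structure (Dle Dge : D -> Prop) :=
  [/\ iso_closed Dle /\ iso_closed Dge,
      forall (X Y : D) (f : dhom X Y 0),
        Dle X -> t_class Dge 1 Y -> closed f -> cohomologous f 0,
      (forall X, Dle X -> t_class Dle 1 X) /\
      (forall X, t_class Dge 1 X -> Dge X) &
      forall X : D, exists (U V SU : D) (hU : dhom U SU (-1))
          (u : dhom U X 0) (v : dhom X V 0) (w : dhom V SU 0),
        [/\ Dle U, t_class Dge 1 V & distinguished hU u v w]].

Definition extended_heart (Dle Dge : D -> Prop) (n : nat) : dgCat k :=
  full_sub (fun X : D => Dle X /\ t_class Dge (- n%:Z + 1) X).

End TStructures.

(* Main.v *)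
Require Import Defs.
From mathcomp Require Import all_boot all_order all_algebra.
From mathcomp Require Import zify.

(* Put L = D^{<=0} and G = D^{>=1-n}.  These classes are orthogonal to each
   other for Hom^{-n}, L is coreflective and G is reflective in D; this data
   ([heart_data]) is self-dual, so only the half concerning kernels needs a
   direct argument.  A kernel in the heart is the coreflection into L of the
   fiber in D.  If g is an n-epimorphism in the heart, the long exact sequence
   of its fiber F shows that F is orthogonal to G (coreflecting the test object
   into the heart), hence that F lies in the heart; so a homotopy kernel of g in
   the heart is a fiber in D, and stability makes it a cofiber sequence. *)

Set Implicit Arguments.
Unset Strict Implicit.
Unset Printing Implicit Defensive.

Import Order.TTheory GRing.Theory Num.Theory.
Local Open Scope ring_scope.

(** * Cohomology and the long exact sequence of a fiber *)

(** Hom complexes vanish in positive degrees, so they know Hom(X, Y[i]) only for i <= 0, and every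
    long exact sequence breaks off at degree 0. Shifts are therefore encoded by closed morphisms of
    degree -m, with bijectivity demanded only where it can hold. The same restriction explains the
    degree -n: Y lies in D^{>=1-n} iff Y[-n] lies in D^{>=1}, and Hom(X, Y[-n]) is H^{-n} of the Hom
    complex. An n-epimorphism supplies injectivity in the adjacent degree -n+1, which is visible
    because n > 0. The second obstacle is that exactness in the heart is tested only on objects of
    the heart. Passing to exactness in D rests on a Yoneda argument: to identify a complex over g
    with the fiber of g, it suffices to test it on its own first object and on the fiber. This is
    why the fiber has to be placed in the heart. *)

Section Complexes.
Variable k : comPzRingType.
Implicit Types C D E : complex k.

Lemma coboundaryP C i (x : C i) :
  coboundary x <-> exists y : C (i - 1), x = df C (subrK 1 i) y.
Proof.
split=> [[j [e [y ->]]]|[y ->]]; last by exists (i - 1), (subrK 1 i), y.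
have ej : j = i - 1 by rewrite -e addrK.
by subst j; exists y; rewrite (eq_irrelevance e (subrK 1 i)).
Qed.

Lemma coboundary_df C i j (e : i + 1 = j) (x : C i) : coboundary (df C e x).
Proof. by exists i, e, x. Qed.

Lemma cocycleE C i j (e : i + 1 = j) (x : C i) : df C e x = 0 -> cocycle x.
Proof. by move=> dx l e'; subst j l. Qed.

Lemma coboundary0 C i : coboundary (0 : C i).
Proof. by apply/coboundaryP; exists 0; rewrite df0. Qed.

Lemma coboundaryD C i (x y : C i) :
  coboundary x -> coboundary y -> coboundary (x + y).
Proof.
move=> /coboundaryP[a ->] /coboundaryP[b ->].
by rewrite -dfD; exact: coboundary_df.
Qed.

Lemma coboundaryZ C i a (x : C i) : coboundary x -> coboundary (a *: x).
Proof. by move=> /coboundaryP[b ->]; rewrite -dfZ; exact: coboundary_df. Qed.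

Lemma coboundaryN C i (x : C i) : coboundary x -> coboundary (- x).
Proof. by rewrite -scaleN1r; exact: coboundaryZ. Qed.

Lemma cocycle0 C i : cocycle (0 : C i).
Proof. by move=> j e; rewrite df0. Qed.

Lemma cocycleZ C i a (x : C i) : cocycle x -> cocycle (a *: x).
Proof. by move=> cx j e; rewrite dfZ cx scaler0. Qed.

Lemma cocycleB C i (x y : C i) : cocycle x -> cocycle y -> cocycle (x - y).
Proof. by move=> cx cy j e; rewrite dfB cx cy subr0. Qed.

Lemma coboundary_cocycle C i (x : C i) : coboundary x -> cocycle x.
Proof. by move=> /coboundaryP[y ->] j e; rewrite df_df. Qed.

Lemma coh_refl C i (x : C i) : cohomologous x x.
Proof. by rewrite /cohomologous subrr; exact: coboundary0. Qed.

Lemma coh_sym C i (x y : C i) : cohomologous x y -> cohomologous y x.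
Proof. by move=> /coboundaryN; rewrite opprB. Qed.

Lemma coh_trans C i (y x z : C i) :
  cohomologous x y -> cohomologous y z -> cohomologous x z.
Proof. by move=> xy /(coboundaryD xy); rewrite addrA subrK. Qed.

Lemma coh0 C i (x : C i) : cohomologous x 0 <-> coboundary x.
Proof. by rewrite /cohomologous subr0. Qed.

Lemma coh_coboundary C i (x y : C i) :
  cohomologous x y -> coboundary y -> coboundary x.
Proof. by move=> xy /(coboundaryD xy); rewrite subrK. Qed.

(** What is needed to induce a homomorphism on cohomology. A single component, possibly changing the
    degree, is enough, so composition with a closed morphism of any degree and the projection from a
    fiber are covered. *)
Definition hmap C D i j (F : C i -> D j) :=
  [/\ {morph F : x y / x - y}, forall x, cocycle x -> cocycle (F x)
    & forall x, coboundary x -> coboundary (F x)].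

Lemma hmap_coh C D i j (F : C i -> D j) x y :
  hmap F -> cohomologous x y -> cohomologous (F x) (F y).
Proof. by case=> FB _ Fb /Fb; rewrite FB. Qed.

Lemma H_injectiveP C D i j (F : C i -> D j) : hmap F ->
  H_injective F <-> forall x, cocycle x -> coboundary (F x) -> coboundary x.
Proof.
move=> [FB Fc Fb]; split=> [injF x cx bx|injF x y cx cy].
  apply/coh0/injF => //; first exact: cocycle0.
  have -> : F 0 = 0 by rewrite -(subrr (F 0)) -FB subrr.
  exact/coh0.
by rewrite /cohomologous -FB; apply: injF; exact: cocycleB.
Qed.

Lemma H_bijective_eq C D i j (F G : C i -> D j) :
  (forall x, cocycle x -> cohomologous (F x) (G x)) ->
  H_bijective F -> H_bijective G.
Proof.
move=> FG [injF surjF]; split=> [x y cx cy Gxy|z cz].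
  apply: injF => //; apply: coh_trans (FG x cx) _.
  by apply: coh_trans Gxy _; exact/coh_sym/FG.
have [x [cx Fxz]] := surjF z cz; exists x; split=> //.
by apply: coh_trans Fxz; exact/coh_sym/FG.
Qed.

Section Composite.
Variables (C D E : complex k) (i j l : int).
Variables (F : C i -> D j) (G : D j -> E l) (GF : C i -> E l).
Hypotheses (hF : hmap F) (hG : hmap G).
Hypothesis GFE : forall x, cocycle x -> cohomologous (GF x) (G (F x)).

Lemma H_bijective_comp : H_bijective F -> H_bijective G -> H_bijective GF.
Proof.
move=> [injF surjF] [injG surjG].
apply: (@H_bijective_eq _ _ _ _ (G \o F)) => [x cx|]; first exact/coh_sym/GFE.
have [_ Fc _] := hF; split=> [x y cx cy /injG h|z cz].
  by apply: injF => //; apply: h; exact: Fc.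
have [y [cy yz]] := surjG z cz; have [x [cx xy]] := surjF y cy.
by exists x; split=> //; apply: coh_trans yz; exact: hmap_coh hG _.
Qed.

Lemma H_bijective_cancell : H_bijective G -> H_bijective GF -> H_bijective F.
Proof.
move=> [injG surjG] [injGF surjGF]; have [_ Fc _] := hF.
have [_ Gc _] := hG; split=> [x y cx cy Fxy|z cz].
  apply: injGF => //; apply: coh_trans (GFE cx) _.
  by apply: coh_trans (coh_sym (GFE cy)); exact: hmap_coh.
have [x [cx xz]] := surjGF _ (Gc _ cz); exists x; split=> //.
by apply: injG => //; [exact: Fc|apply: coh_trans xz; exact/coh_sym/GFE].
Qed.

Lemma H_bijective_cancelr : H_bijective F -> H_bijective GF -> H_bijective G.
Proof.
move=> [injF surjF] [injGF surjGF]; have [_ Fc _] := hF.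
split=> [x y cx cy|z cz].
  have [x' [cx' xx']] := surjF x cx; have [y' [cy' yy']] := surjF y cy.
  move=> Gxy; have [Gx Gy] := (hmap_coh hG xx', hmap_coh hG (coh_sym yy')).
  apply: coh_trans (coh_sym xx') (coh_trans _ yy').
  apply: hmap_coh => //; apply: injGF => //; apply: coh_trans (GFE cx') _.
  apply: coh_trans (coh_sym (GFE cy')).
  exact: coh_trans (coh_trans Gx Gxy) Gy.
have [x [cx xz]] := surjGF z cz; exists (F x); split; first exact: Fc.
by apply: coh_trans xz; exact/coh_sym/GFE.
Qed.

End Composite.

Lemma H_bijective_inv C D i j (F : C i -> D j) (G : D j -> C i) :
  hmap F -> hmap G -> (forall x, cocycle x -> cohomologous (G (F x)) x) ->
  (forall y, cocycle y -> cohomologous (F (G y)) y) -> H_bijective F.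
Proof.
move=> hF hG GF FG; have [_ Gc _] := hG; split=> [x y cx cy Fxy|z cz].
  apply: coh_trans (coh_sym (GF x cx)) _; apply: coh_trans (GF y cy).
  exact: hmap_coh.
by exists (G z); split; [exact: Gc|exact: FG].
Qed.

Lemma H_zero_bijective C D i j (F : C i -> D j) :
  hmap F -> H_bijective F -> H_zero C i <-> H_zero D j.
Proof.
move=> hF [/(H_injectiveP hF) injF surjF]; have [FB Fc Fb] := hF.
split=> [z x cx|z x cx]; apply/coh0.
  have [y [cy yx]] := surjF x cx; apply: coh_coboundary (coh_sym yx) _.
  by apply: Fb; exact/coh0/z.
by apply: injF => //; apply/coh0/z; exact: Fc.
Qed.

Lemma hmap_chainmap C D (F : chainmap C D) i : hmap (F i).
Proof.
have FB : {morph F i : x y / x - y}.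
  move=> x y; rewrite addrC -scaleN1r [RHS]addrC -scaleN1r.
  exact: cm_linear.
split=> // [x cx j e|x [j [e [y ->]]]].
  rewrite -cm_df cx.
  suff h j' : F j' 0 = 0 by [].
  have := @cm_linear _ _ _ F j' (-1) 0 0.
  by rewrite scaleN1r oppr0 addr0 scaleN1r addNr.
by rewrite cm_df; exact: coboundary_df.
Qed.

Lemma chainmapB C D (F : chainmap C D) i x y : F i (x - y) = F i x - F i y.
Proof. by case: (hmap_chainmap F i). Qed.

Lemma chainmap0 C D (F : chainmap C D) i : F i 0 = 0.
Proof. by rewrite -(subrr 0) chainmapB subrr. Qed.

Lemma chainmapD C D (F : chainmap C D) i x y : F i (x + y) = F i x + F i y.
Proof.
rewrite -[y in LHS]opprK chainmapB -[- y]sub0r chainmapB chainmap0 sub0r.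
by rewrite opprK.
Qed.

End Complexes.

Section FibLES.
Variables (k : comPzRingType) (M N : complex k) (G : chainmap M N).

Lemma fib_dfE i (m : M (i - 1)) (w : N (i - 1 - 1)) :
  df (Fib G) (subrK 1 i) (m, w)
  = (df M (subrK 1 i) m, - G _ m - df N (subrK 1 (i - 1)) w).
Proof.
congr (_, _); rewrite (eq_irrelevance (fib_deg_map _) (erefl _)) /=.
by rewrite (eq_irrelevance (fib_deg_df _) (subrK 1 (i - 1))).
Qed.

Lemma fib_coboundaryP i (x : Fib G i) :
  coboundary x <-> exists m w,
    x = (df M (subrK 1 i) m, - G _ m - df N (subrK 1 (i - 1)) w).
Proof.
split=> [/coboundaryP[[m w] ->]|[m [w ->]]].
  by exists m, w; rewrite fib_dfE.
by rewrite -fib_dfE; exact: coboundary_df.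
Qed.

Lemma fib_cocycleP i (x : Fib G i) :
  cocycle x <-> cocycle x.1 /\ df N (subrK 1 i) x.2 = - G _ x.1.
Proof.
split=> [cx|[cy dz]].
  have e1 := cx (i + 1) erefl; split.
    by apply: (cocycleE (e := erefl (i + 1))); case: e1.
  (* Generalising the degree proofs lets [i + 1 - 1] be rewritten to [i], after which [castdeg]
     computes away. *)
  case: e1 => _; move: (fib_deg_map _) (fib_deg_df _).
  rewrite addrK => e e'; rewrite (eq_irrelevance e (erefl _)) /=.
  by rewrite (eq_irrelevance e' (subrK 1 i)) => /eqP; rewrite subr_eq0 => /eqP.
apply: (cocycleE (e := erefl (i + 1))); congr (_, _); first exact: cy.
move: (fib_deg_map _) (fib_deg_df _).
rewrite addrK => e e'; rewrite (eq_irrelevance e (erefl _)) /=.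
by rewrite (eq_irrelevance e' (subrK 1 i)) dz subrr.
Qed.

Variables (C : complex k) (Phi : chainmap C (Fib G)).

Lemma fib_fst_hmap i : hmap (fun x => (Phi i x).1).
Proof.
have [PB Pc Pb] := hmap_chainmap Phi i; split=> [x y|x /Pc|x /Pb].
- by rewrite PB.
- by case/fib_cocycleP.
- by case/fib_coboundaryP => m [w ->]; exact: coboundary_df.
Qed.

Lemma fib_snd_df i (x : C (i - 1)) :
  (Phi i (df C (subrK 1 i) x)).2
  = - G _ (Phi _ x).1 - df N (subrK 1 (i - 1)) (Phi _ x).2.
Proof. by rewrite cm_df; case: (Phi _ x) => m w; rewrite fib_dfE. Qed.

(** Exactness at H^i(M) of the long exact sequence, with C in place of the fiber: if G y = dz, then
    (y, -z) is a cocycle of the fiber. *)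
Lemma fib_exact_mid i (y : M i) : H_surjective (Phi i) ->
  cocycle y -> coboundary (G _ y) ->
  exists x, cocycle x /\ cohomologous (Phi i x).1 y.
Proof.
move=> surj cy /coboundaryP[z Gyz].
have [|x [cx]] := surj (y, - z).
  by apply/fib_cocycleP; rewrite /= dfN Gyz.
move=> /fib_coboundaryP[m [w e]]; exists x; split=> //.
by case: e => e _; rewrite /cohomologous /= e; exact: coboundary_df.
Qed.

(** The kernel of H^i(Fib) -> H^i(M) is the image of H^{i-1}(N). *)
Lemma fib_injective i : H_injective (Phi i) -> H_zero N (i - 1) ->
  H_injective (fun x => (Phi i x).1).
Proof.
move=> /(H_injectiveP (hmap_chainmap _ _)) inj zN.
apply/(H_injectiveP (fib_fst_hmap _)) => x cx /coboundaryP[m e].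
apply: inj => //; have [_ Pc _] := hmap_chainmap Phi i.
(* Subtracting this boundary kills the first component; what remains is a cocycle of N in degree
   i-1. *)
pose q := Phi i x - df (Fib G) (subrK 1 i) (m, 0).
have cq : cocycle q.
  by apply: cocycleB; [exact: Pc|exact/coboundary_cocycle/coboundary_df].
have q1 : q.1 = 0 by rewrite /q fib_dfE /= e subrr.
have /fib_cocycleP[_ dq] := cq.
have /coh0/coboundaryP[w qw] : cohomologous q.2 0.
  apply: zN; apply: (cocycleE (e := subrK 1 i)).
  by rewrite dq q1 chainmap0 oppr0.
apply/fib_coboundaryP; exists m, (- w); rewrite dfN opprK -qw /q fib_dfE -e.
rewrite [LHS]surjective_pairing; congr (_, _) => /=.
by rewrite df0 subr0 !opprK [RHS]addrCA [- _ + _]addNr addr0.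
Qed.

Lemma fib_bijective i : H_bijective (Phi i) -> H_zero N i -> H_zero N (i - 1) ->
  H_bijective (fun x => (Phi i x).1).
Proof.
move=> [inj surj] z0 z1; split; first exact: fib_injective.
move=> y cy; apply: fib_exact_mid => //; apply/coh0/z0.
by have [_ + _] := hmap_chainmap G i; apply.
Qed.

Lemma fib_H_zero i : H_injective (Phi i) ->
  H_zero M i -> H_zero N (i - 1) -> H_zero C i.
Proof.
move=> inj zM zN x cx; apply/coh0.
have /(H_injectiveP (fib_fst_hmap _)) := fib_injective inj zN; apply=> //.
by apply/coh0/zM; have [_ + _] := fib_fst_hmap i; apply.
Qed.

(* The segment H^{i-1}(C) -> H^{i-1}(M) -> H^{i-1}(N) -> H^i(C) -> H^i(M). *)
Lemma fib_H_zero_last i : H_surjective (Phi i) ->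
  H_surjective (fun x => (Phi (i - 1) x).1) ->
  H_injective (fun x => (Phi i x).1) -> H_zero N (i - 1).
Proof.
move=> surj surjF /(H_injectiveP (fib_fst_hmap _)) injF z cz; apply/coh0.
(* The class of (0, z) is the image of z under the connecting map. *)
have [|x [cx]] := surj (0, z).
  apply/fib_cocycleP; rewrite /= chainmap0 oppr0 cz; split=> //.
  exact: cocycle0.
move=> /fib_coboundaryP[m [w exy]].
have /= ex := congr1 fst exy; have {exy} /= ez := congr1 snd exy.
rewrite subr0 in ex.
have /coboundaryP[x' xx'] : coboundary x.
  by apply: injF => //; rewrite ex; exact: coboundary_df.
(* The primitives m and x' of the same boundary differ by a cocycle of M, which surjectivity lifts
   to C; correcting x' by the lift makes its first component agree with m up to a coboundary. *)
have [|x'' [cx'' /coboundaryP[m' em']]] := surjF (m - (Phi _ x').1).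
  apply: (cocycleE (e := subrK 1 i)); rewrite dfB -ex xx' cm_df.
  by case: (Phi _ x') => a b; rewrite fib_dfE subrr.
pose t := x' + x''.
have dt : x = df C (subrK 1 i) t by rewrite dfD cx'' addr0.
have mt : m = (Phi _ t).1 - df M (subrK 1 (i - 1)) m'.
  rewrite -em' /t chainmapD opprB /=; move: (Phi _ x').1 (Phi _ x'').1 => a b.
  by rewrite [RHS]addrACA subrr addr0 addrC subrK.
rewrite {1}dt fib_snd_df mt chainmapB cm_df in ez.
have -> : z = df N (subrK 1 (i - 1)) (w - (Phi _ t).2 - G _ m').
  rewrite !dfB.
  move: (df N _ w) (df N _ _) (G _ _) (df N _ _) ez => a b c d ez.
  have -> : z = - c - d - (- (c - b) - a) by rewrite -ez subKr.
  rewrite opprD !opprK [- c - d]addrC -addrA -[c - b + a]addrA addKr.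
  by rewrite addrA addrC addrA.
exact: coboundary_df.
Qed.

Section AcyclicMiddle.
Hypotheses (G0 : forall i m, G i m = 0) (zM : forall i, H_zero M i).

(** With G = 0 the fiber is the direct sum of M and N[-1]. *)
Lemma fib_acyclic_coboundary i (x : Fib G i) :
  coboundary x <-> coboundary x.1 /\ coboundary x.2.
Proof.
split=> [/fib_coboundaryP[m [w ->]] /=|[/coboundaryP[m xm] /coboundaryP[w xw]]].
  rewrite G0 oppr0 sub0r; split; first exact: coboundary_df.
  exact/coboundaryN/coboundary_df.
apply/fib_coboundaryP; exists m, (- w).
by rewrite G0 oppr0 sub0r dfN opprK -xm -xw -surjective_pairing.
Qed.

(** When M is acyclic, the second projection from the fiber to N[-1] is an isomorphism on
    cohomology. This will turn exactness of X -> 0 -> S into the shift property of its homotopy. *)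
Lemma fib_snd_bijective i :
  H_bijective (Phi i) <-> H_bijective (fun x => (Phi i x).2).
Proof.
have coP (x y : Fib G i) : cocycle x -> cocycle y ->
    cohomologous x.2 y.2 -> cohomologous x y.
  move=> cx cy x2; apply/fib_acyclic_coboundary; split=> //.
  by apply/coh0/zM; case/fib_cocycleP: (cocycleB cx cy).
have [_ Pc _] := hmap_chainmap Phi i.
split=> -[inj surj]; split=> [x y cx cy Kxy|z cz].
- by apply: inj => //; apply: coP => //; exact: Pc.
- have [|x [cx /fib_acyclic_coboundary[_ xz]]] := surj (0, z).
    apply/fib_cocycleP; rewrite G0 oppr0 cz; split=> //; exact: cocycle0.
  by exists x.
- by apply: inj => //; case/fib_acyclic_coboundary: Kxy.
case/fib_cocycleP: (cz) => _; rewrite G0 oppr0 => /cocycleE/surj[x [cx xz]].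
by exists x; split=> //; apply: coP => //; exact: Pc.
Qed.

End AcyclicMiddle.

End FibLES.

(** * Composition in cohomology *)

Section Composition.
Variables (k : comPzRingType) (A : dgCat k).
Implicit Types W X Y Z : A.

(** The differential lands in degree 1, where non-positivity makes everything zero. *)
Lemma closed0 X Y (f : dhom X Y 0) : cocycle f.
Proof. by move=> j e; apply: dnonpos; rewrite -e. Qed.

Lemma closed_comp X Y Z i j l (e : i + j = l) (g : dhom Y Z i)
  (f : dhom X Y j) : cocycle g -> cocycle f -> cocycle (dcomp e g f).
Proof.
move=> cg cf l' el.
have eg : (i + 1) + j = l' by rewrite addrAC e.
have ef : i + (j + 1) = l' by rewrite addrA e.
rewrite (dleibniz e erefl erefl el eg ef) cg cf.
by rewrite dcomp0l dcomp0r scaler0 addr0.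
Qed.

Lemma coboundary_compl X Y Z i j l (e : i + j = l) (g : dhom Y Z i)
  (f : dhom X Y j) : coboundary g -> cocycle f -> coboundary (dcomp e g f).
Proof.
move=> [i' [ei [g' ->]]] cf.
have el : (i' + j) + 1 = l by rewrite addrAC ei.
have ef : i' + (j + 1) = l by rewrite addrA.
exists (i' + j), el, (dcomp erefl g' f).
by rewrite (dleibniz erefl ei erefl el e ef) cf dcomp0r scaler0 addr0.
Qed.

Lemma coboundary_compr X Y Z i j l (e : i + j = l) (g : dhom Y Z i)
  (f : dhom X Y j) : cocycle g -> coboundary f -> coboundary (dcomp e g f).
Proof.
move=> cg [j' [ej [f' ->]]].
have el : (i + j') + 1 = l by rewrite -addrA ej.
have eg : (i + 1) + j' = l by rewrite -addrA [1 + _]addrC ej.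
exists (i + j'), el, (ksgn i *: dcomp erefl g f').
rewrite dfZ (dleibniz erefl erefl ej el eg e) cg dcomp0l add0r scalerA ksgnK.
by rewrite scale1r.
Qed.

Lemma dcompBl X Y Z i j l (e : i + j = l) (g g' : dhom Y Z i)
  (f : dhom X Y j) : dcomp e (g - g') f = dcomp e g f - dcomp e g' f.
Proof. by rewrite dcompDl dcompNl. Qed.

Lemma dcompBr X Y Z i j l (e : i + j = l) (g : dhom Y Z i)
  (f f' : dhom X Y j) : dcomp e g (f - f') = dcomp e g f - dcomp e g f'.
Proof. by rewrite dcompDr dcompNr. Qed.

Lemma coh_compl X Y Z i j l (e : i + j = l) (g g' : dhom Y Z i)
  (f : dhom X Y j) : cocycle f ->
  cohomologous g g' -> cohomologous (dcomp e g f) (dcomp e g' f).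
Proof.
by move=> cf gg'; rewrite /cohomologous -dcompBl; exact: coboundary_compl.
Qed.

Lemma coh_compr X Y Z i j l (e : i + j = l) (g : dhom Y Z i)
  (f f' : dhom X Y j) : cocycle g ->
  cohomologous f f' -> cohomologous (dcomp e g f) (dcomp e g f').
Proof.
by move=> cg ff'; rewrite /cohomologous -dcompBr; exact: coboundary_compr.
Qed.

Lemma hmap_post W X Y d i j (e : d + i = j) (s : dhom X Y d) : cocycle s ->
  hmap (fun u : dhom W X i => dcomp e s u : dhom W Y j).
Proof.
move=> cs; split=> [u v|u cu|u bu]; first exact: dcompBr.
- exact: closed_comp.
- exact: coboundary_compr.
Qed.

Lemma hmap_pre W X Y d i j (e : i + d = j) (s : dhom X Y d) : cocycle s ->
  hmap (fun u : dhom Y W i => dcomp e u s : dhom X W j).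
Proof.
move=> cs; split=> [u v|u cu|u bu]; first exact: dcompBl.
- exact: closed_comp.
- exact: coboundary_compl.
Qed.

Lemma dcomp_did1 X Y i (e : 0 + i = i) (a : dhom Y Y 0) (u : dhom X Y i) :
  cohomologous a (did Y) -> cocycle u -> cohomologous (dcomp e a u) u.
Proof.
move=> ha cu; rewrite -[u in X in cohomologous _ X](dcomp1f e).
exact: coh_compl.
Qed.

Lemma dcomp_did2 X Y i (e : i + 0 = i) (a : dhom X X 0) (u : dhom X Y i) :
  cohomologous a (did X) -> cocycle u -> cohomologous (dcomp e u a) u.
Proof.
move=> ha cu; rewrite -[u in X in cohomologous _ X](dcompf1 e).
exact: coh_compr.
Qed.

(** The bound i <= 0 cannot be dropped: for d = -1 and i = 1 it would compare the zero group with
    H^0 of the maps from W to Y. *)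
Definition post_bij d X Y (s : dhom X Y d) W :=
  forall i j (e : d + i = j), i <= 0 ->
  H_bijective (fun u : dhom W X i => dcomp e s u : dhom W Y j).

Definition pre_bij d X Y (s : dhom X Y d) W :=
  forall i j (e : i + d = j), i <= 0 ->
  H_bijective (fun u : dhom Y W i => dcomp e u s : dhom X W j).

(* For d = -m: Y is X[m], seen from both sides. *)
Definition suspends d X Y (s : dhom X Y d) :=
  cocycle s /\ forall W, post_bij s W /\ pre_bij s W.

Lemma post_bij_comp a b c (e : b + a = c) X Y Z (s : dhom X Y a)
    (t : dhom Y Z b) W : a <= 0 -> cocycle s -> cocycle t ->
  post_bij s W -> post_bij t W -> post_bij (dcomp e t s) W.
Proof.
move=> a0 cs ct bs bt i j eij i0.
have e1 : b + (a + i) = j by rewrite addrA e.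
apply: (H_bijective_comp (hmap_post W (erefl (a + i)) cs) (hmap_post W e1 ct)).
- by move=> x cx; rewrite (dcompA _ _ erefl e1); exact: coh_refl.
- exact: bs.
- by apply: bt; lia.
Qed.

Lemma pre_bij_comp a b c (e : b + a = c) X Y Z (s : dhom X Y a)
    (t : dhom Y Z b) W : b <= 0 -> cocycle s -> cocycle t ->
  pre_bij s W -> pre_bij t W -> pre_bij (dcomp e t s) W.
Proof.
move=> a0 cs ct bs bt i j eij i0.
have e1 : (i + b) + a = j by rewrite -addrA e.
apply: (H_bijective_comp (hmap_pre W (erefl (i + b)) ct) (hmap_pre W e1 cs)).
- by move=> x cx; rewrite (dcompA erefl e1 e eij); exact: coh_refl.
- exact: bt.
- by apply: bs; lia.
Qed.

Lemma suspends_comp a b c (e : b + a = c) X Y Z (s : dhom X Y a)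
    (t : dhom Y Z b) : a <= 0 -> b <= 0 ->
  suspends s -> suspends t -> suspends (dcomp e t s).
Proof.
move=> a0 b0 [cs bs] [ct bt]; split=> [|W]; first exact: closed_comp.
have [[? ?] [? ?]] := (bs W, bt W).
by split; [exact: post_bij_comp|exact: pre_bij_comp].
Qed.

Lemma suspends_iso X Y (a : dhom X Y 0) : H0_iso a -> suspends a.
Proof.
move=> [ca [b [cb [ba ab]]]]; split=> // W; split=> i j e i0.
  have ej : j = i by rewrite -e add0r.
  rewrite {}ej in e *.
  apply: (@H_bijective_inv _ _ _ _ _ _ (fun u => dcomp e b u)).
  - exact: hmap_post.
  - exact: hmap_post.
  - by move=> u cu; rewrite -(dcompA (addr0 0) e e e); exact: dcomp_did1.
  - by move=> u cu; rewrite -(dcompA (addr0 0) e e e); exact: dcomp_did1.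
have ej : j = i by rewrite -e addr0.
rewrite {}ej in e *.
apply: (@H_bijective_inv _ _ _ _ _ _ (fun u => dcomp e u b)).
- exact: hmap_pre.
- exact: hmap_pre.
- by move=> u cu; rewrite (dcompA e e (addr0 0) e); exact: dcomp_did2.
- by move=> u cu; rewrite (dcompA e e (addr0 0) e); exact: dcomp_did2.
Qed.

Lemma suspends_H_zero_post d X Y (s : dhom X Y d) W i j : suspends s ->
  d + i = j -> i <= 0 -> H_zero (dhom W X) i <-> H_zero (dhom W Y) j.
Proof.
move=> [cs bs] e i0; have [b _] := bs W.
exact: (H_zero_bijective (hmap_post W e cs) (b i j e i0)).
Qed.

Lemma suspends_H_zero_pre d X Y (s : dhom X Y d) W i j : suspends s ->
  i + d = j -> i <= 0 -> H_zero (dhom Y W) i <-> H_zero (dhom X W) j.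
Proof.
move=> [cs bs] e i0; have [_ b] := bs W.
exact: (H_zero_bijective (hmap_pre W e cs) (b i j e i0)).
Qed.

Lemma H0_iso_did X : H0_iso (did X).
Proof.
split; first exact: closed0.
exists (did X); split; first exact: closed0.
by rewrite /comp0 dcomp1f; split; exact: coh_refl.
Qed.

Lemma H0_isomorphic_sym X Y : H0_isomorphic X Y -> H0_isomorphic Y X.
Proof. by case=> a [ca [b [cb [ba ab]]]]; exists b; split=> //; exists a. Qed.

(** Both objects corepresent the degree-d cohomology of maps out of X: each class factors through
    the other, and injectivity makes the two factorisations mutually inverse. *)
Lemma pre_bij_unique d X S S' (s : dhom X S d) (s' : dhom X S' d) :
  cocycle s -> cocycle s' ->
  (forall W, pre_bij s W) -> (forall W, pre_bij s' W) ->
  exists a : dhom S S' 0, H0_iso a /\ cohomologous (dcomp (add0r d) a s) s'.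
Proof.
move=> cs cs' bs bs'.
have [a [ca as']] := (bs S' 0 d (add0r d) (lexx 0)).2 s' cs'.
have [b [cb bs_]] := (bs' S 0 d (add0r d) (lexx 0)).2 s cs.
have key Y (t : dhom X Y d) Y' (t' : dhom X Y' d)
    (u : dhom Y Y' 0) (v : dhom Y' Y 0) :
    cocycle t -> (forall W, pre_bij t W) ->
    cohomologous (dcomp (add0r d) u t) t' ->
    cohomologous (dcomp (add0r d) v t') t ->
    cohomologous (comp0 v u) (did Y).
  move=> ct bt ut vt.
  apply: (bt Y 0 d (add0r d) (lexx 0)).1; try exact: closed0.
  rewrite /= (dcompA _ _ (add0r d) (add0r d)) dcomp1f; apply: coh_trans vt.
  by apply: coh_compr => //; exact: closed0.
exists a; split=> //; split=> //; exists b; split=> //.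
by split; [exact: key as' bs_|exact: key bs_ as'].
Qed.

(** Being zero in H^0 propagates to all degrees, because the identity of O is a coboundary and every
    cocycle factors through it. *)
Lemma H0_zero_object_H_zero O X : H0_zero_object O ->
  forall i, H_zero (dhom X O) i /\ H_zero (dhom O X) i.
Proof.
move=> zO i; have /coh0 bid : cohomologous (did O) 0.
  by apply: (zO O).1; exact: closed0.
split=> u cu; apply/coh0.
  by rewrite -(dcomp1f (add0r i) u); exact: coboundary_compl.
by rewrite -(dcompf1 (addr0 i) u); apply: coboundary_compr.
Qed.

(** In cohomology the identity of S is a sum of maps through X and through Y, so a cocycle of any
    degree out of S is detected on the two summands. *)
Lemma H_zero_biprod_post X Y S W i : H0_biproduct X Y S ->
  H_zero (dhom X W) i -> H_zero (dhom Y W) i -> H_zero (dhom S W) i.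
Proof.
move=> [i1 [i2 [p1 [p2 [_ [_ _ _ _ hS]]]]]] zX zY u cu; apply/coh0.
apply: coh_coboundary (coh_sym (dcomp_did2 (addr0 i) hS cu)) _.
rewrite dcompDr; apply: coboundaryD; rewrite -(dcompA (addr0 i) (addr0 i)).
  apply: coboundary_compl (closed0 _); apply/coh0/zX.
  by apply: closed_comp => //; exact: closed0.
apply: coboundary_compl (closed0 _); apply/coh0/zY.
by apply: closed_comp => //; exact: closed0.
Qed.

Lemma H_zero_biprod_pre X Y S W i : H0_biproduct X Y S ->
  H_zero (dhom W X) i -> H_zero (dhom W Y) i -> H_zero (dhom W S) i.
Proof.
move=> [i1 [i2 [p1 [p2 [_ [_ _ _ _ hS]]]]]] zX zY u cu; apply/coh0.
apply: coh_coboundary (coh_sym (dcomp_did1 (add0r i) hS cu)) _.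
rewrite dcompDl; apply: coboundaryD; rewrite (dcompA _ _ (add0r i) (add0r i)).
  apply: coboundary_compr (closed0 _) _; apply/coh0/zX.
  by apply: closed_comp => //; exact: closed0.
apply: coboundary_compr (closed0 _) _; apply/coh0/zY.
by apply: closed_comp => //; exact: closed0.
Qed.

End Composition.

(** * Opposites *)

(** Chain maps that agree only pointwise have distinct fibers with the same underlying modules; the
    comparison maps are therefore equated in the product of modules. *)
Lemma fib_bijective_ext (k : comPzRingType) (C M N : complex k)
    (G G' : chainmap M N)
    (Phi : chainmap C (Fib G)) (Phi' : chainmap C (Fib G')) (i : int) :
  (forall j x, G j x = G' j x) ->
  (forall x, Phi i x = Phi' i x :> M i * N (i - 1)) ->
  H_bijective (Phi i) -> H_bijective (Phi' i).
Proof.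
move=> GG' PP'.
have cob (x : M i * N (i - 1)) :
    coboundary (x : Fib G' i) <-> coboundary (x : Fib G i).
  by split=> /fib_coboundaryP[m [w ->]]; apply/fib_coboundaryP; exists m, w;
    rewrite GG'.
have coc (x : M i * N (i - 1)) :
    cocycle (x : Fib G' i) -> cocycle (x : Fib G i).
  by move=> /fib_cocycleP[c d]; apply/fib_cocycleP; rewrite GG'.
case=> inj surj; split=> [x y cx cy /cob Pxy|z /coc /surj[x [cx xz]]].
  by apply: inj => //; rewrite /cohomologous !PP'.
by exists x; split=> //; apply/cob; move: xz; rewrite /cohomologous PP'.
Qed.

Section Opposite.
Variables (k : comPzRingType) (A : dgCat k).

Lemma op_dcomp0l (X Y Z : op A) i (e : 0 + i = i) (g : dhom Y Z 0)
  (f : dhom X Y i) :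
  dcomp e g f = dcomp (addr0 i) (f : @dhom k A Y X i) (g : @dhom k A Z Y 0).
Proof.
rewrite /= /op_comp mul0r scale1r; congr (dcomp _ _ _); exact: eq_irrelevance.
Qed.

Lemma op_dcomp0r (X Y Z : op A) i (e : i + 0 = i) (g : dhom Y Z i)
  (f : dhom X Y 0) :
  dcomp e g f = dcomp (add0r i) (f : @dhom k A Y X 0) (g : @dhom k A Z Y i).
Proof.
rewrite /= /op_comp mulr0 scale1r; congr (dcomp _ _ _); exact: eq_irrelevance.
Qed.

Fact hc_op_dh (X Y Z : A) (T : hcomplex3 X Y Z) :
  df (@dhom k (op A) Z X) (addNr 1) (hc_h T)
  = - @comp0 k (op A) Z Y X (hc_f T) (hc_g T).
Proof. by rewrite /comp0 op_dcomp0l [LHS]hc_dh. Qed.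

Definition hc_op (X Y Z : A) (T : hcomplex3 X Y Z) :
    @hcomplex3 k (op A) Z Y X :=
  HComplex3 (A := op A) (hc_g_closed T) (hc_f_closed T) (hc_op_dh T).

Fact hc_unop_dh (X Y Z : op A) (T : hcomplex3 X Y Z) :
  df (@dhom k A Z X) (addNr 1) (hc_h T)
  = - @comp0 k A Z Y X (hc_f T) (hc_g T).
Proof. by rewrite [LHS]hc_dh /comp0 op_dcomp0l. Qed.

Definition hc_unop (X Y Z : op A) (T : hcomplex3 X Y Z) :
    @hcomplex3 k A Z Y X :=
  HComplex3 (A := A) (hc_g_closed T) (hc_f_closed T) (hc_unop_dh T).

Section Compare.
Variables (X Y Z : A) (T : hcomplex3 X Y Z) (T' : @hcomplex3 k (op A) Z Y X).
Hypotheses (efg : hc_f T' = hc_g T) (egf : hc_g T' = hc_f T).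
Hypothesis ehh : hc_h T' = hc_h T.

(** The sign [ksgn i] in [right_cmp] is the Koszul sign of composing in [op A] with h of degree -1.
    Working with a pair T, T' serves both [hc_op] and [hc_unop]. *)
Lemma left_cmp_op (W : A) i :
  H_bijective (@left_cmp k (op A) _ _ _ T' W i)
  <-> H_bijective (right_cmp T W i).
Proof.
have e1 j (x : @dhom k A Y W j) :
    @postcomp k (op A) W Y X _ (hc_g_closed T') j x
    = @precomp k A X Y W _ (hc_f_closed T) j x.
  by rewrite /= egf; exact: op_dcomp0l.
have e2 (x : @dhom k A Z W i) :
    @left_cmp k (op A) _ _ _ T' W i x = right_cmp T W i x
    :> @dhom k A Y W i * @dhom k A X W (i - 1).
  congr (_, _); first by rewrite efg; exact: op_dcomp0l.
  rewrite ehh /= /op_comp; congr (_ *: _); first by rewrite /ksgn mulN1r abszN.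
  by congr (dcomp _ _ _); exact: eq_irrelevance.
by split; apply: fib_bijective_ext.
Qed.

Lemma right_cmp_op (W : A) i :
  H_bijective (@right_cmp k (op A) _ _ _ T' W i)
  <-> H_bijective (left_cmp T W i).
Proof.
have e1 j (x : @dhom k A W Y j) :
    @precomp k (op A) Z Y W _ (hc_f_closed T') j x
    = @postcomp k A W Y Z _ (hc_g_closed T) j x.
  by rewrite /= efg; exact: op_dcomp0r.
have e2 (x : @dhom k A W X i) :
    @right_cmp k (op A) _ _ _ T' W i x = left_cmp T W i x
    :> @dhom k A W Y i * @dhom k A W Z (i - 1).
  congr (_, _); first by rewrite egf; exact: op_dcomp0r.
  rewrite ehh /= /op_comp scalerA mulrN1 /ksgn abszN ksgnK scale1r.
  by congr (dcomp _ _ _); exact: eq_irrelevance.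
by split; apply: fib_bijective_ext.
Qed.

End Compare.

End Opposite.

(** * Exactness against one test object *)

Section LeftExact.
Variables (k : comPzRingType) (A : dgCat k).

Definition left_exact_at (X Y Z : A) (T : hcomplex3 X Y Z) (W : A) :=
  forall i : int, i <= 0 -> H_bijective (left_cmp T W i).

Definition right_exact_at (X Y Z : A) (T : hcomplex3 X Y Z) (W : A) :=
  forall i : int, i <= 0 -> H_bijective (right_cmp T W i).

Lemma left_exactP (X Y Z : A) (T : hcomplex3 X Y Z) :
  left_exact T <-> forall W, left_exact_at T W.
Proof. by []. Qed.

Lemma right_exactP (X Y Z : A) (T : hcomplex3 X Y Z) :
  right_exact T <-> forall W, right_exact_at T W.
Proof. by []. Qed.

Section Precomp.
Variables (U X Y Z : A) (T : hcomplex3 X Y Z) (u : dhom U X 0).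

Fact hc_precomp_dh :
  df (dhom U Z) (addNr 1) (dcomp (addr0 (-1)) (hc_h T) u)
  = - comp0 (hc_g T) (comp0 (hc_f T) u).
Proof.
rewrite -(precomp_df (closed0 u)) hc_dh dcompNl /comp0.
by rewrite (dcompA _ _ (addr0 0) (addr0 0)).
Qed.

Definition hc_precomp : hcomplex3 U Y Z :=
  HComplex3 (closed0 (comp0 (hc_f T) u)) (hc_g_closed T) hc_precomp_dh.

(** If W cannot distinguish U from X, then neither can exactness tested on W. Here u will be the
    coreflection of a fiber. *)
Lemma left_exact_at_precomp W :
  left_exact_at T W -> post_bij u W -> left_exact_at hc_precomp W.
Proof.
move=> lT bu i i0; have cu := closed0 u.
apply: (H_bijective_comp (hmap_post W (add0r i) cu)
         (hmap_chainmap (left_cmp T W) i)).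
- move=> x cx.
  suff -> : left_cmp hc_precomp W i x
    = left_cmp T W i (dcomp (add0r i) u x) by exact: coh_refl.
  rewrite /= /left_cmp_fun /=; congr (_, _).
    by rewrite (dcompA _ _ (add0r i) (add0r i)).
  by rewrite (dcompA _ _ (add0r i) (addrC (-1) i)).
- exact: bu.
- exact: lT.
Qed.

End Precomp.

Section Comparison.
Variables (Y Z : A) (g : dhom Y Z 0) (cg : cocycle g).

Section Action.
Variables (W X : A) (i : int) (x : dhom W X i).
Fact fib_act_deg : 0 - 1 + i = i - 1.
Proof. by rewrite sub0r addrC. Qed.

(** Naturality of the fiber in the test object: a map to Y with a homotopy over Z is restricted
    along x. The degree [0 - 1] is the form in which [Fib] presents -1. *)
Definition fib_act (p : Fib (postcomp X cg) 0) : Fib (postcomp W cg) i :=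
  (dcomp (add0r i) p.1 x, dcomp fib_act_deg p.2 x).

Lemma fib_act_coh (p q : Fib (postcomp X cg) 0) : cocycle x ->
  cohomologous p q -> cohomologous (fib_act p) (fib_act q).
Proof.
move=> cx /fib_coboundaryP[m [w pq]]; apply/fib_coboundaryP.
have e2 : 0 - 1 - 1 + i = i - 1 - 1 by rewrite !sub0r; lia.
exists (dcomp fib_act_deg m x), (dcomp e2 w x).
have dx j (e : i + 1 = j) : df _ e x = 0 by exact: cx.
have dxE a b c d (e : a + i = c) (ea : a + 1 = b) (ec : c + 1 = d)
  (e' : b + i = d) Y' (v : dhom X Y' a) :
    df _ ec (dcomp e v x) = dcomp e' (df _ ea v) x.
  have e3 : a + (i + 1) = d by rewrite addrA e.
  by rewrite (dleibniz _ ea erefl _ e' e3) dx dcomp0r scaler0 addr0.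
rewrite (dxE _ _ _ _ _ (subrK 1 0) _ (add0r i)).
rewrite (dxE _ _ _ _ _ (subrK 1 (0 - 1)) _ fib_act_deg).
have [p1 p2] := (congr1 fst pq, congr1 snd pq).
rewrite /= in p1 p2; congr (_, _); rewrite /= -?dcompBl ?p1 //.
by rewrite p2 dcompBl dcompNl (dcompA _ _ fib_act_deg (add0r (i - 1))).
Qed.

End Action.

(** Fixing g makes the comparison maps of all complexes over g land in the same fibers. *)
Definition hc_over X (f : dhom X Y 0) (h : dhom X Z (-1))
    (dh : df (dhom X Z) (addNr 1) h = - comp0 g f) : hcomplex3 X Y Z :=
  HComplex3 (closed0 f) cg dh.

Variables (X1 X2 : A) (f1 : dhom X1 Y 0) (f2 : dhom X2 Y 0).
Variables (h1 : dhom X1 Z (-1)) (h2 : dhom X2 Z (-1)).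
Hypothesis dh1 : df (dhom X1 Z) (addNr 1) h1 = - comp0 g f1.
Hypothesis dh2 : df (dhom X2 Z) (addNr 1) h2 = - comp0 g f2.
Let T1 := hc_over dh1.
Let T2 := hc_over dh2.

(** Yoneda: agreement on the universal element, the identity of X1, gives agreement on every test
    object. *)
Lemma left_cmp_factor (a : dhom X1 X2 0) W i (x : dhom W X1 i) :
  cohomologous (left_cmp T2 X1 0 a) (left_cmp T1 X1 0 (did X1)) ->
  cocycle x ->
  cohomologous (left_cmp T2 W i (dcomp (add0r i) a x)) (left_cmp T1 W i x).
Proof.
move=> ha cx; have := fib_act_coh cx ha.
suff [-> ->] : fib_act x (left_cmp T2 X1 0 a)
      = left_cmp T2 W i (dcomp (add0r i) a x)
    /\ fib_act x (left_cmp T1 X1 0 (did X1)) = left_cmp T1 W i x by [].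
split; rewrite /fib_act /= /left_cmp_fun /=; congr (_, _).
- exact: dcompA.
- exact: dcompA.
- by rewrite (dcompA _ _ (add0r i) (add0r i)) dcomp1f.
by rewrite (dcompA _ _ (add0r i) (addrC (-1) i)) dcomp1f.
Qed.

End Comparison.

(** Exactness of T2 gives a map X1 -> X2 over g, exactness of T1 at X2 gives one back, and
    injectivity at X1 and X2 makes them inverse in H^0. So T1 inherits exactness on every test
    object from T2. *)
Lemma left_exact_unique (X1 X2 Y Z : A)
    (T1 : hcomplex3 X1 Y Z) (T2 : hcomplex3 X2 Y Z) :
  hc_g T2 = hc_g T1 -> left_exact T2 -> left_exact_at T1 X1 ->
  left_exact_at T1 X2 -> left_exact T1.
Proof.
case: T1 T2 => [f1 g h1 cf1 cg dh1] [f2 g2 h2 cf2 cg2 dh2] /= eg.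
subst g2 => l2 l11 l12.
pose T1 := hc_over cg dh1; pose T2 := hc_over cg dh2.
have {}l2 W : left_exact_at T2 W.
  by move=> i i0; apply: fib_bijective_ext (l2 W i i0).
have {}l11 : left_exact_at T1 X1.
  by move=> i i0; apply: fib_bijective_ext (l11 i i0).
have {}l12 : left_exact_at T1 X2.
  by move=> i i0; apply: fib_bijective_ext (l12 i i0).
have [_ Pc1 _] := hmap_chainmap (left_cmp T1 X1) 0.
have [_ Pc2 _] := hmap_chainmap (left_cmp T2 X2) 0.
have [a [ca ha]] := (l2 X1 0 (lexx 0)).2 _ (Pc1 _ (closed0 (did X1))).
have [b [cb hb]] := (l12 0 (lexx 0)).2 _ (Pc2 _ (closed0 (did X2))).
have isoa : H0_iso a.
  split=> //; exists b; split=> //; split.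
    apply: (l11 0 (lexx 0)).1; try exact: closed0.
    apply: coh_trans ha; have := left_cmp_factor hb ca.
    by rewrite (eq_irrelevance (add0r 0) (addr0 0)).
  apply: (l2 X2 0 (lexx 0)).1; try exact: closed0.
  apply: coh_trans hb; have := left_cmp_factor ha cb.
  by rewrite (eq_irrelevance (add0r 0) (addr0 0)).
apply/left_exactP => W i i0; have [_ ba] := suspends_iso isoa.
apply: (@fib_bijective_ext _ _ _ _ _ _ (left_cmp T1 W)) => //.
apply: (H_bijective_comp (hmap_post W (add0r i) ca)
         (hmap_chainmap (left_cmp T2 W) i)).
- by move=> x cx; exact/coh_sym/left_cmp_factor.
- by have [+ _] := ba W; apply.
- exact: l2.
Qed.

End LeftExact.

Lemma left_exact_at_op (k : comPzRingType) (A : dgCat k) (X Y Z : A)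
    (T : hcomplex3 X Y Z) (W : A) :
  @left_exact_at k (op A) _ _ _ (hc_op T) W <-> right_exact_at T W.
Proof.
split=> bT i i0;
  by apply/(@left_cmp_op k A _ _ _ T (hc_op T) erefl erefl erefl); exact: bT.
Qed.

Lemma right_exact_at_op (k : comPzRingType) (A : dgCat k) (X Y Z : A)
    (T : hcomplex3 X Y Z) (W : A) :
  @right_exact_at k (op A) _ _ _ (hc_op T) W <-> left_exact_at T W.
Proof.
split=> bT i i0;
  by apply/(@right_cmp_op k A _ _ _ T (hc_op T) erefl erefl erefl); exact: bT.
Qed.

Lemma right_exact_at_unop (k : comPzRingType) (A : dgCat k) (X Y Z : op A)
    (T : hcomplex3 X Y Z) (W : op A) :
  @right_exact_at k A _ _ _ (hc_unop T) W <-> left_exact_at T W.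
Proof.
split=> bT i i0;
  by apply/(@left_cmp_op k A _ _ _ (hc_unop T) T erefl erefl erefl); exact: bT.
Qed.

Lemma short_exact_op (k : comPzRingType) (A : dgCat k) (X Y Z : A)
  (T : hcomplex3 X Y Z) : short_exact T -> short_exact (hc_op T).
Proof.
move=> [lT rT]; split.
  by apply/left_exactP => W; apply/left_exact_at_op; exact: rT.
by apply/right_exactP => W; apply/right_exact_at_op; exact: lT.
Qed.

(** The shift is absorbed into the degree -n: no suspension occurs in the fields, so passing to
    [op A] merely exchanges L with G, kernels with cokernels, and reflections with coreflections. *)
Record heart_data (k : comPzRingType) (A : dgCat k) (L G : A -> Prop)
    (n : nat) : Prop := HeartData {
  hd_orth : forall (X Y : A) (i : int),
    L X -> G Y -> i <= - n%:Z -> H_zero (dhom X Y) i;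
  hd_perpL : forall X : A, (forall V, G V -> H_zero (dhom X V) (- n%:Z)) -> L X;
  hd_perpG : forall Y : A, (forall U, L U -> H_zero (dhom U Y) (- n%:Z)) -> G Y;
  hd_corefl : forall X : A, exists (U : A) (u : dhom U X 0),
    L U /\ forall W, L W -> post_bij u W;
  hd_refl : forall X : A, exists (V : A) (v : dhom X V 0),
    G V /\ forall W, G W -> pre_bij v W;
  hd_fiber : forall (Y Z : A) (g : dhom Y Z 0),
    exists (X : A) (T : hcomplex3 X Y Z), hc_g T = g /\ short_exact T;
  hd_cofiber : forall (X Y : A) (f : dhom X Y 0),
    exists (Z : A) (T : hcomplex3 X Y Z), hc_f T = f /\ short_exact T
}.

Lemma heart_data_op (k : comPzRingType) (A : dgCat k) (L G : A -> Prop) n :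
  heart_data L G n -> @heart_data k (op A) G L n.
Proof.
case=> orth perpL perpG corefl refl fiber cofiber; split.
- by move=> X Y i GX LY; exact: orth.
- exact: perpG.
- exact: perpL.
- move=> X; have [V [v [GV bv]]] := refl X.
  exists V, v; split=> // W GW i j e i0.
  have ej : j = i by rewrite -e add0r.
  rewrite {}ej in e *; apply: H_bijective_eq (bv W GW i i (addr0 i) i0) => x _.
  by rewrite op_dcomp0l; exact: coh_refl.
- move=> X; have [V [v [GV bv]]] := corefl X.
  exists V, v; split=> // W GW i j e i0.
  have ej : j = i by rewrite -e addr0.
  rewrite {}ej in e *; apply: H_bijective_eq (bv W GW i i (add0r i) i0) => x _.
  by rewrite op_dcomp0r; exact: coh_refl.
- move=> Y Z g; have [X [T [eT [lT rT]]]] := cofiber Z Y g.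
  exists X, (hc_op T); split=> //; exact: short_exact_op.
move=> Y Z g; have [X [T [eT [lT rT]]]] := fiber Z Y g.
by exists X, (hc_op T); split=> //; exact: short_exact_op.
Qed.

(** * Kernels and left exact complexes in the heart *)

Section Heart.
Variables (k : comPzRingType) (A : dgCat k) (L G : A -> Prop) (n : nat).
Hypothesis hd : heart_data L G n.

Let H X := L X /\ G X.

(** H^{-n}(W, X) sits between H^{-n-1}(W, Z) and H^{-n}(W, Y), which both vanish. Letting W run over
    L shows that a fiber of a map between objects of G lies in G. *)
Lemma H_zero_fiber (X Y Z : A) (T : hcomplex3 X Y Z) W : left_exact T ->
  L W -> G Y -> G Z -> H_zero (dhom W X) (- n%:Z).
Proof.
move=> lT LW GY GZ; have n0 : - n%:Z <= 0 by lia.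
apply: (fib_H_zero (lT W _ n0).1); first exact: (hd_orth hd).
by apply: (hd_orth hd) => //; lia.
Qed.

(** Membership in G is tested by maps from L, which do not distinguish X from its coreflection. *)
Lemma coreflection_heart (X : A) : G X ->
  exists U (u : dhom U X 0), H U /\ forall W, L W -> post_bij u W.
Proof.
move=> GX; have [U [u [LU bu]]] := hd_corefl hd X; exists U, u; split=> //.
split=> //; apply: (hd_perpG hd) => W LW.
apply/(H_zero_bijective (hmap_post W (add0r _) (closed0 u))).
  by apply: bu => //; lia.
exact: (hd_orth hd).
Qed.

Lemma heart_kernel (Y Z : A) (g : dhom Y Z 0) : G Y -> G Z ->
  exists X (T : hcomplex3 X Y Z),
    [/\ H X, hc_g T = g & forall W, L W -> left_exact_at T W].
Proof.
move=> GY GZ; have [K [T [eT [lT _]]]] := hd_fiber hd g.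
have GK : G K by apply: (hd_perpG hd) => W LW; exact: H_zero_fiber lT _ _ _.
have [U [u [HU bu]]] := coreflection_heart GK.
exists U, (hc_precomp T u); split=> // W LW.
by apply: left_exact_at_precomp; [exact: lT|exact: bu].
Qed.

Lemma heart_left_exact (X Y Z : A) (T : hcomplex3 X Y Z) : (0 < n)%N ->
  H X -> H Y -> H Z -> (forall W, H W -> left_exact_at T W) ->
  (forall W, H W -> forall x : dhom Z W (- n%:Z + 1), cocycle x ->
    coboundary (dcomp (addr0 _) x (hc_g T)) -> coboundary x) ->
  left_exact T.
Proof.
move=> n0 HX [LY GY] [LZ GZ] lT epi.
have [F [T' [eT' [lT' rT']]]] := hd_fiber hd (hc_g T).
(* With F in the heart, both test objects X and F are covered by the hypothesis on T. *)
suff HF : H F by apply: left_exact_unique eT' lT' _ _; exact: lT.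
split; last by apply: (hd_perpG hd) => W LW; exact: H_zero_fiber lT' _ _ _.
apply: (hd_perpL hd) => V GV.
(* The segment used is H^{-n}(Z, V) -> H^{-n}(Y, V) -> H^{-n}(F, V) -> H^{-n+1}(Z, V) -> H^{-n+1}(Y,
   V); its top degree is at most 0 because n > 0. *)
have e1 : - n%:Z = - n%:Z + 1 - 1 by rewrite addrK.
have i0 : - n%:Z + 1 <= 0 by lia.
rewrite e1; apply: (fib_H_zero_last (rT' V _ i0).2).
  (* H^{-n}(Y, V) = 0 by orthogonality, so 0 is a preimage up to coboundary. *)
  move=> z cz; exists 0; split; first exact: cocycle0.
  rewrite /= dcomp0l; apply: coh_sym; apply: (hd_orth hd) => //.
  by rewrite -e1.
apply/(H_injectiveP (fib_fst_hmap _ _)) => x cx /= bx.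
(* The hypothesis on g concerns targets in the heart only. As Y and Z lie in L, maps from them to V
   are the same as maps to its coreflection U. *)
have [U [u [HU bu]]] := coreflection_heart GV.
have [cu cg'] := (closed0 u, closed0 (hc_g T')).
have [x' [cx' xx']] := (bu Z LZ _ _ (add0r _) i0).2 x cx.
apply: coh_coboundary (coh_sym xx') _; apply: coboundary_compr => //.
apply: epi => //; rewrite -eT'.
have /(H_injectiveP (hmap_post _ _ cu)) inj := (bu Y LY _ _ (add0r _) i0).1.
apply: inj; first exact: closed_comp.
rewrite -(dcompA (add0r _) (addr0 _)).
by apply: coh_coboundary bx; exact: coh_compl.
Qed.

End Heart.

(** * Suspensions in stable DG-categories *)

Lemma H_bijective_sign (k : comPzRingType) (C D : complex k) (i j : int)
    (a : k) (F : C i -> D j) : a * a = 1 ->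
  H_bijective (fun x => a *: F x) -> H_bijective F.
Proof.
move=> aa [inj surj]; split=> [x y cx cy Fxy|z cz].
  by apply: inj => //; rewrite /cohomologous -scalerBr; exact: coboundaryZ.
have [x [cx xz]] := surj _ (cocycleZ a cz); exists x; split=> //.
have := coboundaryZ a xz.
by rewrite -scalerBr scalerA aa scale1r.
Qed.

Section Stable.
Variables (k : comPzRingType) (D : dgCat k).
Hypothesis sD : stable D.

Lemma stable_fiber (Y Z : D) (g : dhom Y Z 0) :
  exists (X : D) (T : hcomplex3 X Y Z), hc_g T = g /\ short_exact T.
Proof.
have [[_ pre] eqv] := sD; have [[X [T [eT lT]]] _] := pre Y Z g (closed0 g).
by exists X, T; split=> //; apply/(eqv _ _ _ T).2/(eqv _ _ _ T).1.
Qed.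

Lemma stable_cofiber (X Y : D) (f : dhom X Y 0) :
  exists (Z : D) (T : hcomplex3 X Y Z), hc_f T = f /\ short_exact T.
Proof.
have [[_ pre] eqv] := sD; have [_ [Z [T [eT rT]]]] := pre X Y f (closed0 f).
by exists Z, T; split=> //; apply/(eqv _ _ _ T).2.
Qed.

Section ZeroMiddle.
Variables (O X S : D) (T : hcomplex3 X O S).
Hypothesis zO : H0_zero_object O.

(** As maps from W to O are acyclic, the fiber has the cohomology of maps to S shifted by one, and
    exactness becomes the shift property of h. Since O is zero only in H^0, g = 0 is asked of the
    morphism itself. *)
Lemma left_cmp_suspension W i : hc_g T = 0 ->
  H_bijective (left_cmp T W i)
  <-> H_bijective (fun u : dhom W X i => dcomp (addrC (-1) i) (hc_h T) u).
Proof.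
move=> g0; apply: fib_snd_bijective => [j m|j]; first by rewrite /= g0 dcomp0l.
by case: (H0_zero_object_H_zero W zO j).
Qed.

Lemma right_cmp_suspension W i : hc_f T = 0 ->
  H_bijective (right_cmp T W i)
  <-> H_bijective (fun u : dhom S W i => dcomp (erefl (i - 1)) u (hc_h T)).
Proof.
move=> f0; have sgn := ksgnK k i.
have -> : H_bijective (right_cmp T W i) <-> H_bijective (fun u : dhom S W i =>
    ksgn i *: dcomp (erefl (i - 1)) u (hc_h T)).
  apply: fib_snd_bijective => [j m|j]; first by rewrite /= f0 dcomp0r.
  by case: (H0_zero_object_H_zero W zO j).
split=> [|bh]; first exact: H_bijective_sign.
apply: (H_bijective_sign sgn); apply: H_bijective_eq bh => x _.
by rewrite scalerA sgn scale1r; exact: coh_refl.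
Qed.

Lemma suspends_of_short_exact : hc_f T = 0 -> hc_g T = 0 -> short_exact T ->
  suspends (hc_h T).
Proof.
move=> f0 g0 [lT rT]; split.
  by apply: (cocycleE (e := addNr 1)); rewrite hc_dh f0 /comp0 dcomp0r oppr0.
move=> W; split=> i j e i0.
  have e' : i - 1 = j by rewrite addrC.
  case: _ / e' e => e; rewrite (eq_irrelevance e (addrC (-1) i)).
  exact/(left_cmp_suspension W i g0)/lT.
by case: _ / e; exact/(right_cmp_suspension W i f0)/rT.
Qed.

End ZeroMiddle.

Lemma zero_hcomplex_dh (O X S : D) (h : dhom X S (-1)) : cocycle h ->
  df (dhom X S) (addNr 1) h = - comp0 (0 : dhom O S 0) (0 : dhom X O 0).
Proof. by move=> ch; rewrite ch /comp0 dcomp0r oppr0. Qed.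

(** In a stable category the homotopy cokernel X -> 0 -> S is also a homotopy kernel, so a one-sided
    universal property yields the two-sided one. *)
Lemma suspends_of_pre (X S : D) (h : dhom X S (-1)) : cocycle h ->
  (forall W, pre_bij h W) -> suspends h.
Proof.
move=> ch bh; have [[[[O zO] _] _] eqv] := sD.
pose T := HComplex3 (@closed0 k D X O 0) (@closed0 k D O S 0)
  (zero_hcomplex_dh O ch).
apply: (suspends_of_short_exact (T := T) zO) => //; apply/(eqv _ _ _ T).2.
apply/right_exactP => W i i0; apply/(right_cmp_suspension zO) => //.
exact: bh.
Qed.

Lemma suspends_of_post (X S : D) (h : dhom X S (-1)) : cocycle h ->
  (forall W, post_bij h W) -> suspends h.
Proof.
move=> ch bh; have [[[[O zO] _] _] eqv] := sD.
pose T := HComplex3 (@closed0 k D X O 0) (@closed0 k D O S 0)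
  (zero_hcomplex_dh O ch).
apply: (suspends_of_short_exact (T := T) zO) => //; apply/(eqv _ _ _ T).2.
apply/(eqv _ _ _ T).1.
apply/left_exactP => W i i0; apply/(left_cmp_suspension zO) => //.
exact: bh.
Qed.

Lemma is_suspensionP (X S : D) (h : dhom X S (-1)) :
  is_suspension h <-> suspends h.
Proof.
split=> [[ch bh]|[ch bh]].
  by apply: suspends_of_pre => // W i j e i0; case: _ / e; exact: bh.
by split=> // W i i0; have [_] := bh W; apply.
Qed.

Lemma suspension_exists (X : D) :
  exists (S : D) (h : dhom X S (-1)), suspends h.
Proof.
have [[[[O zO] _] _] eqv] := sD.
have [S [T [f0 [_ rT]]]] := stable_cofiber (0 : dhom X O 0).
exists S, (hc_h T); apply: suspends_of_pre.
  by apply: (cocycleE (e := addNr 1)); rewrite hc_dh f0 /comp0 dcomp0r oppr0.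
by move=> W i j e i0; case: _ / e; exact/(right_cmp_suspension zO W i f0)/rT.
Qed.

Lemma desuspension_exists (S : D) :
  exists (X : D) (h : dhom X S (-1)), suspends h.
Proof.
have [[[[O zO] _] _] eqv] := sD.
have [X [T [g0 [lT _]]]] := stable_fiber (0 : dhom O S 0).
exists X, (hc_h T); apply: suspends_of_post.
  by apply: (cocycleE (e := addNr 1)); rewrite hc_dh g0 /comp0 dcomp0l oppr0.
move=> W i j e i0; have e' : i - 1 = j by rewrite addrC.
case: _ / e' e => e; rewrite (eq_irrelevance e (addrC (-1) i)).
exact/(left_cmp_suspension zO W i g0)/lT.
Qed.

Lemma suspends_did (X : D) : suspends (did X).
Proof. exact/suspends_iso/H0_iso_did. Qed.

Lemma suspends_pow m (X : D) :
  exists (Y : D) (s : dhom X Y (- m%:Z)), suspends s.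
Proof.
elim: m X => [|m IH] X; first by exists X, (did X); exact: suspends_did.
have [S [h sh]] := suspension_exists X; have [Y [s ss]] := IH S.
have e : - m%:Z + -1 = - m.+1%:Z by lia.
by exists Y, (dcomp e s h); apply: suspends_comp => //; lia.
Qed.

Lemma desuspends_pow m (Y : D) :
  exists (X : D) (s : dhom X Y (- m%:Z)), suspends s.
Proof.
elim: m Y => [|m IH] Y; first by exists Y, (did Y); exact: suspends_did.
have [S [h sh]] := desuspension_exists Y; have [X [s ss]] := IH S.
have e : -1 + - m%:Z = - m.+1%:Z by lia.
by exists X, (dcomp e h s); apply: suspends_comp => //; lia.
Qed.

Lemma H0_isomorphic_trans (X Y Z : D) :
  H0_isomorphic X Y -> H0_isomorphic Y Z -> H0_isomorphic X Z.
Proof.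
move=> [a [ca [a' [ca' [aa' a'a]]]]] [b [cb [b' [cb' [bb' b'b]]]]].
have key X1 X2 X3 (u : dhom X1 X2 0) (u' : dhom X2 X1 0) (v : dhom X2 X3 0)
    (v' : dhom X3 X2 0) : cohomologous (comp0 u' u) (did X1) ->
    cohomologous (comp0 v' v) (did X2) ->
    cohomologous (comp0 (comp0 u' v') (comp0 v u)) (did X1).
  move=> uu vv; apply: coh_trans uu; rewrite /comp0.
  rewrite (dcompA _ _ (addr0 0) (addr0 0)).
  rewrite -[dcomp _ v' (dcomp _ v u)](dcompA (addr0 0) (addr0 0)).
  apply: coh_compr; first exact: closed0.
  by apply: dcomp_did1 => //; exact: closed0.
exists (comp0 b a); split; first exact: closed0.
exists (comp0 a' b'); split; first exact: closed0.
by split; exact: key.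
Qed.

Lemma shift_nat_suspends m (X Y : D) : shift_nat m X Y ->
  exists s : dhom X Y (- m%:Z), suspends s.
Proof.
elim: m X => [|m IH] X; first by case=> a /suspends_iso sa; exists a.
move=> [S [h [/is_suspensionP sh /IH[s ss]]]].
have e : - m%:Z + -1 = - m.+1%:Z by lia.
by exists (dcomp e s h); apply: suspends_comp => //; lia.
Qed.

Lemma shift_nat_isor m (X Y Y' : D) :
  shift_nat m X Y -> H0_isomorphic Y Y' -> shift_nat m X Y'.
Proof.
elim: m X => [|m IH] X; first exact: H0_isomorphic_trans.
by move=> [S [h [sh XY]]] YY'; exists S, h; split=> //; exact: IH.
Qed.

Lemma shift_nat_exists m (X : D) : exists Y : D, shift_nat m X Y.
Proof.
elim: m X => [|m IH] X; first by exists X, (did X); exact: H0_iso_did.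
have [S [h /is_suspensionP sh]] := suspension_exists X.
by have [Y SY] := IH S; exists Y, S, h.
Qed.

End Stable.

(** * Shifted truncations *)

Section TStructure.
Variables (k : comPzRingType) (D : dgCat k) (Dle Dge : D -> Prop).
Hypotheses (sD : stable D) (tD : t_structure Dle Dge).

Let Dge1 : D -> Prop := t_class Dge 1.

(** The shift by -1 is a [Negz], for which [shift] exchanges its arguments: the condition on V is
    about a suspension of V. *)
Lemma t_class1P (P : D -> Prop) (V : D) : iso_closed P ->
  t_class P 1 V <-> exists (S : D) (h : dhom V S (-1)), suspends h /\ P S.
Proof.
move=> isoP; split=> [[Z [PZ [S [h [/(is_suspensionP sD) sh SZ]]]]]|].
  by exists S, h; split=> //; exact: isoP (H0_isomorphic_sym SZ) PZ.
move=> [S [h [/(is_suspensionP sD) sh PS]]]; exists S; split=> //.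
by exists S, h; split=> //; exists (did S); exact: H0_iso_did.
Qed.

Lemma Dge_suspends (V S : D) (h : dhom V S (-1)) :
  Dge1 V -> suspends h -> Dge S.
Proof.
have [[_ isoG] _ _ _] := tD.
move=> /(t_class1P _ isoG)[S' [h' [[ch' bh'] GS']]] [ch bh].
have [W|W|a [ia _]] := pre_bij_unique ch' ch.
- by case: (bh' W).
- by case: (bh W).
by apply: isoG GS'; exists a.
Qed.

(** H^{-m}(X, V) is H^0(X[m], V), and Dle is stable under suspension. *)
Lemma t_orth (X V : D) i : Dle X -> Dge1 V -> i <= 0 -> H_zero (dhom X V) i.
Proof.
have [[isoL _] orth [susL _] _] := tD.
move=> + GV i0; have [m ->] : exists m : nat, i = - m%:Z by exists `|i|%N; lia.
elim: m X => [|m IH] X LX; first by move=> x cx; exact: orth.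
have /(t_class1P _ isoL)[S [h [sh LS]]] := susL X LX.
by apply/(suspends_H_zero_pre V sh); last exact: IH; lia.
Qed.

Lemma Dge1_iso (V V' : D) : H0_isomorphic V V' -> Dge1 V -> Dge1 V'.
Proof.
have [[_ isoG] _ _ _] := tD.
move=> /H0_isomorphic_sym[b /suspends_iso sb].
move=> /(t_class1P _ isoG)[S [h [sh GS]]].
apply/(t_class1P _ isoG); exists S, (dcomp (addr0 (-1)) h b); split=> //.
exact: suspends_comp.
Qed.

(** A distinguished triangle is only isomorphic to one coming from a homotopy short exact sequence,
    so X appears as middle term up to isomorphism. *)
Lemma t_truncation (X : D) : exists (A0 A1 A2 : D) (T : hcomplex3 A0 A1 A2),
  [/\ short_exact T, Dle A0, Dge1 A2 & H0_isomorphic A1 X].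
Proof.
have [[isoL _] _ _ trunc] := tD.
have [U [V [SU [hU [u [v [w [LU GV []]]]]]]]] := trunc X.
move=> _ [_ [A0 [A1 [A2 [SA [hA [f0 [f1 [f2 [a0 [a1 [a2 [a3]]]]]]]]]]]]].
case=> [[_ [_ [T [_ _ eT _]]]] [i0 i1 i2 _] _ _].
exists A0, A1, A2, T; split=> //; last by exists a1.
- by apply: isoL LU; apply: H0_isomorphic_sym; exists a0.
- by apply: Dge1_iso GV; apply: H0_isomorphic_sym; exists a2.
Qed.

(** In the truncation sequence of X the map A1 -> A2 is null, so A0 -> A1 has a section, which turns
    out to be a two-sided inverse. *)
Lemma Dle_perp (X : D) :
  (forall V, Dge1 V -> H_zero (dhom X V) 0) -> Dle X.
Proof.
move=> zX; have [[isoL _] _ _ _] := tD.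
have [A0 [A1 [A2 [T [[lT _] LA0 GA2 A1X]]]]] := t_truncation X.
have zA : H_zero (dhom A1 A2) 0.
  have [b /suspends_iso sb] := A1X.
  by apply/(suspends_H_zero_pre A2 sb (addr0 0) (lexx 0)); exact: zX.
have [s [cs /= sid]] : exists x : dhom A1 A0 0, cocycle x /\
    cohomologous (left_cmp T A1 0 x).1 (did A1).
  apply: fib_exact_mid; [exact: (lT A1 0 (lexx 0)).2|exact: closed0|].
  by apply/coh0/zA; exact: closed0.
apply: isoL _ (LA0); apply: H0_isomorphic_trans _ (A1X).
have e := eq_irrelevance (add0r 0) (addr0 (0 : int)).
exists (hc_f T); split; first exact: closed0.
exists s; split; first exact: closed0.
split; last by rewrite /comp0 -e.
(* Composition with f is injective on H^0(A0, A0) because H^{-1}(A0, A2) = 0; it sends both s f and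
   the identity to the class of f. *)
have inj := fib_injective (lT A0 0 (lexx 0)).1 (t_orth LA0 GA2 _).
apply: inj => //=; try exact: closed0.
rewrite dcompf1 -(dcompA (add0r 0) (add0r 0)).
by apply: dcomp_did1; [exact: sid|exact: closed0].
Qed.

Lemma Dge1_perp (Y : D) :
  (forall U, Dle U -> H_zero (dhom U Y) 0) -> Dge1 Y.
Proof.
move=> zY; have [A0 [A1 [A2 [T [[_ rT] LA0 GA2 A1Y]]]]] := t_truncation Y.
have zA : H_zero (dhom A0 A1) 0.
  have [b /suspends_iso sb] := A1Y.
  by apply/(suspends_H_zero_post A0 sb (addr0 0) (lexx 0)); exact: zY.
have [r [cr /= rid]] : exists x : dhom A2 A1 0, cocycle x /\
    cohomologous (right_cmp T A1 0 x).1 (did A1).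
  apply: fib_exact_mid; [exact: (rT A1 0 (lexx 0)).2|exact: closed0|].
  by apply/coh0/zA; exact: closed0.
apply: Dge1_iso _ (GA2); apply: H0_isomorphic_trans _ (A1Y).
apply: H0_isomorphic_sym.
exists (hc_g T); split; first exact: closed0.
exists r; split; first exact: closed0.
split; first exact: rid.
have inj := fib_injective (rT A2 0 (lexx 0)).1 (t_orth LA0 GA2 _).
apply: inj => //=; try exact: closed0.
rewrite (dcompA _ _ (addr0 0) (addr0 0)).
rewrite (eq_irrelevance (addr0 0) (add0r 0)) dcomp1f.
rewrite (eq_irrelevance (add0r 0) (addr0 0)).
by apply: dcomp_did2; last exact: closed0.
Qed.

Lemma t_coreflection (X : D) : exists (U : D) (u : dhom U X 0),
  Dle U /\ forall W, Dle W -> post_bij u W.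
Proof.
have [A0 [A1 [A2 [T [[lT _] LA0 GA2 [a ia]]]]]] := t_truncation X.
exists A0, (comp0 a (hc_f T)); split=> // W LW.
have [ca ba] := suspends_iso ia.
apply: post_bij_comp => //; [exact: closed0| |by case: (ba W)].
move=> i j e i0; have ej : j = i by rewrite -e add0r.
rewrite {}ej in e *; rewrite (eq_irrelevance e (add0r i)).
by apply: (fib_bijective (lT W i i0)); apply: t_orth => //; lia.
Qed.

Lemma t_reflection (X : D) : exists (V : D) (v : dhom X V 0),
  Dge1 V /\ forall W, Dge1 W -> pre_bij v W.
Proof.
have [A0 [A1 [A2 [T [[_ rT] LA0 GA2 A1X]]]]] := t_truncation X.
have [b ib] := H0_isomorphic_sym A1X; have [cb bb] := suspends_iso ib.
exists A2, (comp0 (hc_g T) b); split=> // W GW.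
apply: pre_bij_comp => //; [exact: closed0|by case: (bb W)|].
move=> i j e i0; have ej : j = i by rewrite -e addr0.
rewrite {}ej in e *; rewrite (eq_irrelevance e (addr0 i)).
by apply: (fib_bijective (rT W i i0)); apply: t_orth => //; lia.
Qed.

Variable n : nat.
Hypothesis n_gt0 : (0 < n)%N.

Let G : D -> Prop := t_class Dge (- n%:Z + 1).

(** D^{>=1-n} is D^{>=1}[n]: the n-1 shifts of the definition plus the one that carries D^{>=1} to
    Dge. *)
Lemma heart_coaisleP (Y : D) :
  G Y <-> exists (V : D) (s : dhom V Y (- n%:Z)), Dge1 V /\ suspends s.
Proof.
have [[_ isoG] _ _ _] := tD.
have GE : G Y <-> exists Z, Dge Z /\ shift_nat n.-1 Z Y.
  rewrite /G /t_class /shift_class.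
  (* Since n > 0, the shift is a [Posz] and [shift] unfolds to [shift_nat]. *)
  by have -> : - (- n%:Z + 1) = n.-1%:Z by lia.
have e : - n.-1%:Z + -1 = - n%:Z by lia.
split=> [/GE[Z [GZ /(shift_nat_suspends sD)[s ss]]]|[V [s [GV [cs bs]]]]].
  have [V [h sh]] := desuspension_exists sD Z; exists V, (dcomp e s h); split.
    by apply/(t_class1P _ isoG); exists Z, h.
  by apply: suspends_comp => //; lia.
(* Conversely, V[1] lies in Dge, and its shift by n-1 is identified with Y by uniqueness of V[n]. *)
apply/GE; have [S [h sh]] := suspension_exists sD V.
exists S; split; first exact: Dge_suspends GV sh.
have [Y' SY'] := shift_nat_exists sD n.-1 S.
have [s' ss'] := shift_nat_suspends sD SY'.
have [m0 n0] : (-1 : int) <= 0 /\ - n.-1%:Z <= 0 by lia.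
have [ct bt] := suspends_comp e m0 n0 sh ss'.
have [W|W|a [ia _]] := pre_bij_unique ct cs.
- by case: (bt W).
- by case: (bs W).
by apply: shift_nat_isor SY' _; exists a.
Qed.

(* Conjugates the reflection of X[-n] onto D^{>=1} by n-fold suspensions. *)
Lemma heart_reflection (X : D) : exists (V : D) (v : dhom X V 0),
  G V /\ forall W, G W -> pre_bij v W.
Proof.
have n0 : - n%:Z <= 0 by lia.
have [C [hC [cC bC]]] := desuspends_pow sD n X.
have [V0 [v0 [GV0 bv0]]] := t_reflection C.
have [V [hV [cV bV]]] := suspends_pow sD n V0.
have [_ bCV] := bC V.
(* This v is v0[n], characterised by v hC = hV v0 in cohomology. *)
have [v [cv hv]] := (bCV 0 _ (add0r _) (lexx 0)).2
  (dcomp (addr0 _) hV v0) (closed_comp _ cV (closed0 _)).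
exists V, v; split; first by apply/heart_coaisleP; exists V0, hV.
move=> W /heart_coaisleP[W0 [hW [GW0 [cW bW]]]] i j e i0.
have ej : j = i by rewrite -e addr0.
rewrite {}ej in e *.
pose d := i - n%:Z; have eW : - n%:Z + i = d by rewrite addrC.
have [[_ bCW] [_ bVW]] := (bC W, bV W); have cv0 := closed0 v0.
(* The universal property of v0 concerns targets in D^{>=1}; composing with hW carries it from W0 in
   degree i to W = W0[n] in degree i-n. *)
have bv0W : H_bijective (fun u : dhom V0 W d => dcomp (addr0 d) u v0).
  apply: (@H_bijective_cancelr _ _ _ _ _ _ _
    (fun u : dhom V0 W0 i => dcomp eW hW u) _
    (fun u : dhom V0 W0 i => dcomp eW hW (dcomp (addr0 i) u v0))).
  - exact: hmap_post.
  - exact: hmap_pre.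
  - by move=> u cu; rewrite -(dcompA eW (addr0 d)); exact: coh_refl.
  - by have [+ _] := bW V0; apply.
  apply: (H_bijective_comp (hmap_pre W0 (addr0 i) cv0) (hmap_post C eW cW)).
  - by move=> u cu; exact: coh_refl.
  - exact: bv0.
  - by have [+ _] := bW C; apply.
apply: (@H_bijective_cancell _ _ _ _ _ _ _ _
  (fun u : dhom X W i => dcomp (erefl d) u hC)
  (fun u : dhom V W i => dcomp (addr0 d) (dcomp (erefl d) u hV) v0)).
- exact: hmap_pre.
- exact: hmap_pre.
- move=> u cu; rewrite (dcompA _ _ (add0r _) (erefl d)).
  rewrite (dcompA _ _ (addr0 _) (erefl d)).
  by apply: coh_compr => //; exact: coh_sym.
- exact: bCW.
apply: (H_bijective_comp (hmap_pre W (erefl d) cV) (hmap_pre W (addr0 d) cv0)).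
- by move=> u cu; exact: coh_refl.
- exact: bVW.
- exact: bv0W.
Qed.

Lemma t_heart_data : heart_data Dle G n.
Proof.
split.
- move=> X Y i LX /heart_coaisleP[V [s [GV ss]]] iN.
  have e : - n%:Z + (i + n%:Z) = i by rewrite addrC addrK.
  by apply/(suspends_H_zero_post X ss e); [|apply: t_orth => //]; lia.
- move=> X zX; apply: Dle_perp => V GV.
  (* H^0(X, V) = H^{-n}(X, V[n]), and V[n] lies in G. *)
  have [Y [s ss]] := suspends_pow sD n V.
  apply/(suspends_H_zero_post X ss (addr0 _) (lexx 0)); apply: zX.
  by apply/heart_coaisleP; exists V, s.
- move=> Y zY; have [V [s ss]] := desuspends_pow sD n Y.
  apply/heart_coaisleP; exists V, s; split=> //; apply: Dge1_perp => U LU.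
  by apply/(suspends_H_zero_post U ss (addr0 _) (lexx 0)); exact: zY.
- exact: t_coreflection.
- exact: heart_reflection.
- exact: stable_fiber.
- exact: stable_cofiber.
Qed.

End TStructure.

(** * The extended heart *)

Section FullSub.
Variables (k : comPzRingType) (A : dgCat k) (P : A -> Prop).
Variables (X Y Z : full_sub P).

Fact hc_ambient_dh (T : hcomplex3 X Y Z) :
  df (dhom (sval X) (sval Z)) (addNr 1) (hc_h T)
  = - @comp0 k A _ _ _ (hc_g T) (hc_f T).
Proof. exact: (hc_dh T). Qed.

Definition hc_ambient (T : hcomplex3 X Y Z) :
    @hcomplex3 k A (sval X) (sval Y) (sval Z) :=
  HComplex3 (A := A) (hc_f_closed T) (hc_g_closed T) (hc_ambient_dh T).

Fact hc_sub_dh (T : @hcomplex3 k A (sval X) (sval Y) (sval Z)) :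
  df (@dhom k (full_sub P) X Z) (addNr 1) (hc_h T)
  = - @comp0 k (full_sub P) X Y Z (hc_g T) (hc_f T).
Proof. exact: (hc_dh T). Qed.

Definition hc_sub (T : @hcomplex3 k A (sval X) (sval Y) (sval Z)) :
    hcomplex3 X Y Z :=
  HComplex3 (A := full_sub P) (hc_f_closed T) (hc_g_closed T) (hc_sub_dh T).

(** The Hom complexes agree by conversion, but the chain maps carry different opaque proofs, so the
    fibers are compared by [fib_bijective_ext]. *)
Lemma left_exact_at_ambient (T : hcomplex3 X Y Z) (W : full_sub P) :
  left_exact_at (hc_ambient T) (sval W) <-> left_exact_at T W.
Proof. by split=> bT i i0; apply: fib_bijective_ext (bT i i0). Qed.

Lemma right_exact_at_ambient (T : hcomplex3 X Y Z) (W : full_sub P) :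
  right_exact_at (hc_ambient T) (sval W) <-> right_exact_at T W.
Proof. by split=> bT i i0; apply: fib_bijective_ext (bT i i0). Qed.

Lemma left_exact_at_sub T (W : full_sub P) :
  left_exact_at (hc_sub T) W <-> left_exact_at T (sval W).
Proof. by split=> bT i i0; apply: fib_bijective_ext (bT i i0). Qed.

Lemma right_exact_at_sub T (W : full_sub P) :
  right_exact_at (hc_sub T) W <-> right_exact_at T (sval W).
Proof. by split=> bT i i0; apply: fib_bijective_ext (bT i i0). Qed.

Lemma short_exact_of_ambient (T : hcomplex3 X Y Z) :
  short_exact (hc_ambient T) -> short_exact T.
Proof.
move=> [lT rT]; split.
  by apply/left_exactP => W; apply/left_exact_at_ambient; exact: lT.
by apply/right_exactP => W; apply/right_exact_at_ambient; exact: rT.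
Qed.

End FullSub.

Section HeartIsAbelian.
Variables (k : comPzRingType) (D : dgCat k) (L G : D -> Prop) (n : nat).
Hypotheses (sD : stable D) (hd : heart_data L G n) (n_gt0 : (0 < n)%N).

Let H X := L X /\ G X.
Notation heart := (full_sub H).

Lemma heart_truncated : n_truncated heart n.
Proof. by move=> [X [LX GX]] [Y [LY GY]] i iN; exact: (hd_orth hd). Qed.

(** L and G are each determined by vanishing against the other, so they contain the zero objects and
    biproducts of D. *)
Lemma heart_additive : H0_additive heart.
Proof.
have [[[[O zO] bip] _] _] := sD; split.
  have HO : H O.
    split; [apply: (hd_perpL hd) => W _|apply: (hd_perpG hd) => W _];
      by case: (H0_zero_object_H_zero W zO (- n%:Z)).
  by exists (exist _ O HO) => X; exact: zO.
move=> [X [LX GX]] [Y [LY GY]]; have [S bS] := bip X Y.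
have HS : H S.
  split; [apply: (hd_perpL hd) => V GV|apply: (hd_perpG hd) => U LU].
    by apply: H_zero_biprod_post bS _ _; exact: (hd_orth hd).
  by apply: H_zero_biprod_pre bS _ _; exact: (hd_orth hd).
by exists (exist _ S HS).
Qed.

Lemma heart_preabelian : preabelian heart.
Proof.
split; first exact: heart_additive.
move=> [X [LX GX]] [Y [LY GY]] f _; split.
  have [K [T [HK eT lT]]] := heart_kernel hd f GX GY.
  exists (exist _ K HK).
  exists (@hc_sub k D H (exist _ K HK) (exist _ X (conj LX GX))
    (exist _ Y (conj LY GY)) T).
  split=> //; apply/left_exactP => -[W [LW GW]]; apply/left_exact_at_sub.
  exact: lT.
have [C [T [[GC LC] eT lT]]] := heart_kernel (heart_data_op hd) f LY LX.
exists (exist _ C (conj LC GC)).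
exists (@hc_sub k D H (exist _ X (conj LX GX)) (exist _ Y (conj LY GY))
  (exist _ C (conj LC GC)) (hc_unop T)).
split=> //; apply/right_exactP => -[W [LW GW]]; apply/right_exact_at_sub.
by apply/right_exact_at_unop; exact: lT.
Qed.

(** Stability reduces the claim to right exactness in D, which is left exactness in [op D]; there L
    and G trade places and the n-monomorphism f plays the role of the n-epimorphism. *)
Lemma heart_right_exact (X Y Z : heart) (T : hcomplex3 X Y Z) :
  right_exact T -> n_mono n (hc_f T) -> short_exact T.
Proof.
move=> rT [_ mono]; apply: short_exact_of_ambient.
have [_ eqv] := sD; apply/(eqv _ _ _ (hc_ambient T)).2.
have [[LX GX] [LY GY] [LZ GZ]] := And3 (svalP X) (svalP Y) (svalP Z).
suff lop : left_exact (hc_op (hc_ambient T)).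
  by apply/right_exactP => W; apply/left_exact_at_op; exact: lop.
apply: (heart_left_exact (heart_data_op hd) n_gt0) => // W [GW LW].
  apply/left_exact_at_op.
  by apply/(right_exact_at_ambient T (exist _ W (conj LW GW))); exact: rT.
move=> x cx; rewrite op_dcomp0r => bx.
have [+ _] := mono (exist _ W (conj LW GW)).
by move=> /(H_injectiveP (hmap_post _ _ (hc_f_closed T))); apply.
Qed.

Lemma heart_left_exact_short (X Y Z : heart) (T : hcomplex3 X Y Z) :
  left_exact T -> n_epi n (hc_g T) -> short_exact T.
Proof.
move=> lT [_ epi]; apply: short_exact_of_ambient.
have [_ eqv] := sD; apply/(eqv _ _ _ (hc_ambient T)).2.
apply/(eqv _ _ _ (hc_ambient T)).1.
have [HX HY HZ] := And3 (svalP X) (svalP Y) (svalP Z).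
apply: (heart_left_exact hd n_gt0) => // W HW.
  by apply/(left_exact_at_ambient T (exist _ W HW)); exact: lT.
move=> x cx bx; have [+ _] := epi (exist _ W HW).
have cg : @cocycle k (@dhom k (op heart) Z Y) 0 (hc_g T).
  exact: (hc_g_closed T).
move=> /(H_injectiveP (hmap_post _ _ cg)); apply=> //.
by rewrite op_dcomp0l.
Qed.

Lemma heart_abelian : abelian_n_truncated heart n.
Proof.
split; [exact: heart_truncated|exact: heart_preabelian| |].
  exact: heart_right_exact.
exact: heart_left_exact_short.
Qed.

End HeartIsAbelian.

Theorem theorem3 (k : comPzRingType) (D : dgCat k) (Dle Dge : D -> Prop)
  (n : nat) (D_stable : stable D) (D_t : t_structure Dle Dge)
  (n_gt0 : (0 < n)%N) :
  abelian_n_truncated (extended_heart Dle Dge n) n.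
Proof.
exact: heart_abelian D_stable (t_heart_data D_stable D_t n_gt0) n_gt0.
Qed.
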